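(* Let $f\in\mathcal{D}_2(\mathbf{L}_{q,\mathfrak{I}_N})$ be a solution of $\mathbf{L}_{q,\mathfrak{I}_N}f=0$ with $f(x)\neq0$ for all $x\in[0,b]$ and $f(0)=1$, and set $h=f'(0)$. The coefficients $\{a_n(x)\}_{n=0}^\infty$ of the Fourier-Legendre expansion $K^f_{\mathfrak{I}_N}(x,t)=\sum_{n=0}^\infty\frac{a_n(x)}{x}P_n\left(\frac tx\right)$ of the canonical transmutation kernel are given by $$a_n(x)=\left(n+\frac12\right)\left(\sum_{k=0}^nl_{k,n}\frac{\varphi_f^{(k)}(x)}{x^k}-1\right).$$ The coefficients of the expansions $G^f_{\mathfrak{I}_N}(x,t)=\sum_{n=0}^\infty\frac{g_n(x)}{x}P_{2n}\left(\frac tx\right)$ and $S_{\mathfrak{I}_N}(x,t)=\sum_{n=0}^\infty\frac{s_n(x)}{x}P_{2n+1}\left(\frac tx\right)$ of the canonical cosine and sine kernels satisfy, for all $n\in\mathbb{N}_0$, $$g_n(x)=(4n+1)\left(\sum_{k=0}^n\tilde l_{k,n}\frac{\varphi_f^{(2k)}(x)}{x^{2k}}-1\right),\qquad s_n(x)=(4n+3)\left(\sum_{k=0}^n\hat l_{k,n}\frac{\varphi_f^{(2k+1)}(x)}{x^{2k+1}}-1\right).$$ Here $x\in(0,b]$.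
   Context: Let $b>0$, let $q\in L_2(0,b)$ be complex valued, $N\in\mathbb{N}$, $0<x_1<\dots<x_N<b$, $\alpha_1,\dots,\alpha_N\in\mathbb{C}\setminus\{0\}$, $x_0=0$, $x_{N+1}=b$, $\mathfrak{I}_N=\{(x_j,\alpha_j)\}_{j=1}^N$. $\mathcal{D}_2(\mathbf{L}_{q,\mathfrak{I}_N})$ is the set of $u\in AC[0,b]$ such that $u|_{(x_k,x_{k+1})}\in H^2(x_k,x_{k+1})$ for $k=0,\dots,N$ and $u'(x_k+)-u'(x_k-)=\alpha_ku(x_k)$ for $k=1,\dots,N$. A solution of $\mathbf{L}_{q,\mathfrak{I}_N}u=\lambda u$ (formally $-u''+(q+\sum_{k=1}^N\alpha_k\delta(x-x_k))u=\lambda u$) is a function $u\in\mathcal{D}_2(\mathbf{L}_{q,\mathfrak{I}_N})$ satisfying $-u''+qu=\lambda u$ a.e. on each $(x_k,x_{k+1})$. For $h\in\mathbb{C}$, $K^h_{\mathfrak{I}_N}(x,t)$, $0<x\le b$, $|t|\le x$, is the transmutation kernel: the ($\rho$-independent) kernel with $K^h_{\mathfrak{I}_N}\in L_\infty$ and $K^h_{\mathfrak{I}_N}(x,\cdot)\in L_2(-x,x)$ such that $e^h_{\mathfrak{I}_N}(\rho,x)=e^{i\rho x}+\int_{-x}^xK^h_{\mathfrak{I}_N}(x,t)e^{i\rho t}dt$ for all $\rho\in\mathbb{C}$, where $e^h_{\mathfrak{I}_N}(\rho,\cdot)$ is the solution of $\mathbf{L}_{q,\mathfrak{I}_N}u=\rho^2u$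 with $e^h_{\mathfrak{I}_N}(\rho,0)=1$, $(e^h_{\mathfrak{I}_N})'(\rho,0)=i\rho+h$. Such a kernel exists. For $h=f'(0)$ write $K^f_{\mathfrak{I}_N}=K^h_{\mathfrak{I}_N}$, $G^f_{\mathfrak{I}_N}(x,t)=K^f_{\mathfrak{I}_N}(x,t)+K^f_{\mathfrak{I}_N}(x,-t)$, $S_{\mathfrak{I}_N}(x,t)=K^f_{\mathfrak{I}_N}(x,t)-K^f_{\mathfrak{I}_N}(x,-t)$. $P_n$ are the Legendre polynomials, $P_n(z)=\sum_{k=0}^nl_{k,n}z^k$, $\tilde l_{k,n}=l_{2k,2n}$, $\hat l_{k,n}=l_{2k+1,2n+1}$. The Fourier-Legendre series converge in $L_2$ with respect to $t$, and $a_n(x)=\left(n+\frac12\right)\int_{-x}^xK^f_{\mathfrak{I}_N}(x,t)P_n\left(\frac tx\right)dt$, $g_n=2a_{2n}$, $s_n=2a_{2n+1}$. Formal powers: $\widetilde X^{(0)}\equiv X^{(0)}\equiv1$ and, for $k\in\mathbb{N}$, $\widetilde X^{(k)}(x)=k\int_0^x\widetilde X^{(k-1)}(s)\left(f^2(s)\right)^{(-1)^{k-1}}ds$, $X^{(k)}(x)=k\int_0^xX^{(k-1)}(s)\left(f^2(s)\right)^{(-1)^k}ds$; $\varphi_f^{(k)}=f\widetilde X^{(k)}$ for $k$ even and $\varphi_f^{(k)}=fX^{(k)}$ for $k$ odd. *)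

(* Defs.v *)
From HB Require Import structures.
From mathcomp Require Import all_boot all_order all_algebra.
From mathcomp Require Export complex.
From mathcomp Require Import all_classical all_reals all_analysis.

Set Implicit Arguments.
Unset Strict Implicit.
Unset Printing Implicit Defensive.
Import Order.TTheory GRing.Theory Num.Theory.
Import numFieldNormedType.Exports.

Local Open Scope classical_set_scope.
Local Open Scope ring_scope.
Local Open Scope complex_scope.

(* Complex-valued functions of a real variable are
   functions R -> R[i]; differentiation, integration, measurability and limits
   are taken on real and imaginary parts.  "Measurable" means Borel measurable:
   an element of an L_p space is given by a Borel representative.  Functions
   "on [0, b]" are total functions of which only the values on [0, b] are
   constrained. *)

Section ComplexCalculus.
Context {R : realType}.
Local Notation C := R[i].
Local Notation mu := (@lebesgue_measure R).
Implicit Types (u v : R -> C) (A : set R) (F : set_system R).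

Definition expC (z : C) : C :=
  (expR (complex.Re z))%:C * (cos (complex.Im z) +i* sin (complex.Im z)).

Definition Cintegral A u : C :=
  (\int[mu]_(t in A) complex.Re (u t)) +i* (\int[mu]_(t in A) complex.Im (u t)).

Definition Cderive u (x : R) : C :=
  derive1 (fun t => complex.Re (u t)) x +i* derive1 (fun t => complex.Im (u t)) x.

Definition Ccvg F u (l : C) : Prop :=
  (complex.Re (u t) @[t --> F] --> complex.Re l) /\
  (complex.Im (u t) @[t --> F] --> complex.Im l).

(* u'(x+) = l and u'(x-) = l, as one-sided limits of the derivative; at the left
   end point of an interval, u'(0) means u'(0+). *)
Definition deriv_right u (x : R) (l : C) : Prop := Ccvg x^'+ (Cderive u) l.
Definition deriv_left u (x : R) (l : C) : Prop := Ccvg x^'- (Cderive u) l.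

Definition measurableC d (T : measurableType d) (A : set T) (f : T -> C) : Prop :=
  measurable_fun A (fun t => complex.Re (f t)) /\
  measurable_fun A (fun t => complex.Im (f t)).

Definition L2 A u : Prop :=
  ((fun t => complex.Re (u t)) \_ A \in Lfun mu 2%:E) /\
  ((fun t => complex.Im (u t)) \_ A \in Lfun mu 2%:E).

Definition abs_cont (a b : R) u : Prop :=
  forall eps : R, 0 < eps -> exists2 del : R, 0 < del &
    forall (n : nat) (l r : 'I_n -> R),
      (forall i, [/\ a <= l i, l i <= r i & r i <= b]) ->
      (forall i j, i != j -> r i <= l j \/ r j <= l i) ->
      \sum_(i < n) (r i - l i) < del ->
      \sum_(i < n) Normc.normc (u (r i) - u (l i)) < eps.

(* real-valued C_c^\infty functions on ]a, b[; they determine weak derivatives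
   of complex-valued functions by linearity *)
Definition test_function (a b : R) (phi : R -> R) : Prop :=
  (forall n x, derivable (derive1n n phi) x 1) /\
  (exists c d : R, [/\ a < c, d < b & forall x, ~~ (c <= x <= d) -> phi x = 0]).

Definition weak_derivative (a b : R) u v : Prop :=
  forall phi, test_function a b phi ->
    Cintegral `]a, b[ (fun t => u t * (derive1 phi t)%:C) =
    - Cintegral `]a, b[ (fun t => v t * (phi t)%:C).

(* u belongs to H^2(a, b), with weak derivatives u' = v and u'' = w *)
Definition H2_with (a b : R) u v w : Prop :=
  [/\ L2 `]a, b[ u, L2 `]a, b[ v, L2 `]a, b[ w,
      weak_derivative a b u v & weak_derivative a b v w].

Definition H2 (a b : R) u : Prop := exists v w, H2_with a b u v w.

End ComplexCalculus.

(* The nodes are x 0 = 0 < x 1 < ... < x N < x N.+1 = b, and alpha k is the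
   strength of the interaction at x k for 1 <= k <= N; other values of x and
   alpha are irrelevant. *)
Section DeltaInteractions.
Context {R : realType}.
Local Notation C := R[i].
Local Notation mu := (@lebesgue_measure R).
Variables (b : R) (q : R -> C) (N : nat) (x : nat -> R) (alpha : nat -> C).

Definition D2 (u : R -> C) : Prop :=
  [/\ abs_cont 0 b u,
      forall k, (k <= N)%N -> H2 (x k) (x k.+1) u &
      forall k, (1 <= k <= N)%N -> exists dl dr : C,
        [/\ deriv_left u (x k) dl, deriv_right u (x k) dr &
            dr - dl = alpha k * u (x k)]].

Definition is_solution (lambda : C) (u : R -> C) : Prop :=
  D2 u /\
  forall k, (k <= N)%N -> exists v w, H2_with (x k) (x k.+1) u v w /\
    {ae mu, forall t, x k < t < x k.+1 -> - w t + q t * u t = lambda * u t}.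

Definition is_e (h rho : C) (u : R -> C) : Prop :=
  [/\ is_solution (rho ^+ 2) u, u 0 = 1 & deriv_right u 0 ('i%C * rho + h)].

Definition kernel_domain : set (R * R) :=
  [set p | 0 < p.1 <= b /\ `|p.2| <= p.1].

(* e rho plays the role of e^h(rho, .) *)
Definition transmutation_kernel (e : C -> R -> C) (K : R -> R -> C) : Prop :=
  [/\ measurableC kernel_domain (fun p => K p.1 p.2),
      exists M : R, {ae (mu \x mu)%E, forall p,
        kernel_domain p -> Normc.normc (K p.1 p.2) <= M},
      forall y, 0 < y <= b -> L2 `]-y, y[ (K y) &
      forall rho y, 0 < y <= b ->
        e rho y = expC ('i%C * rho * y%:C) +
          Cintegral `[-y, y] (fun t => K y t * expC ('i%C * rho * t%:C))].

End DeltaInteractions.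

Section FormalPowers.
Context {R : realType}.
Local Notation C := R[i].
Variable f : R -> C.

(* in the k.+1 case the exponents (-1)^(k.+1 - 1) and (-1)^k.+1 are integers *)
Fixpoint Xtilde (k : nat) (x : R) : C :=
  if k is k'.+1 then
    k%:R * Cintegral `[0, x] (fun s => Xtilde k' s * (f s ^+ 2) ^ ((-1) ^+ k'))
  else 1.

Fixpoint X (k : nat) (x : R) : C :=
  if k is k'.+1 then
    k%:R * Cintegral `[0, x] (fun s => X k' s * (f s ^+ 2) ^ ((-1) ^+ k))
  else 1.

Definition phi_f (k : nat) (x : R) : C :=
  f x * (if odd k then X k x else Xtilde k x).

End FormalPowers.

Section FourierLegendre.
Context {R : realType}.
Local Notation C := R[i].
Local Notation mu := (@lebesgue_measure R).

(* Rodrigues' formula P_n = (2^n n!)^-1 d^n/dz^n (z^2 - 1)^n *)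
Definition legendre (n : nat) : {poly R} :=
  ((2 ^ n * n`!)%:R)^-1 *: (('X^2 - 1) ^+ n)^`(n).

Definition legendre_coef (k n : nat) : C := ((legendre n)`_k)%:C.

Definition a_coef (K : R -> R -> C) (n : nat) (x : R) : C :=
  (n%:R + 2^-1) *
  Cintegral `[-x, x] (fun t => K x t * ((legendre n).[t / x])%:C).

Definition g_coef (K : R -> R -> C) (n : nat) (x : R) : C :=
  2 * a_coef K (2 * n) x.

Definition s_coef (K : R -> R -> C) (n : nat) (x : R) : C :=
  2 * a_coef K (2 * n).+1 x.

Definition legendre_partial_sum (x : R) (p : nat -> nat) (c : nat -> C)
    (m : nat) (t : R) : C :=
  \sum_(0 <= n < m) c n / x%:C * ((legendre (p n)).[t / x])%:C.

(* F = \sum_n c n / x * P_(p n) (. / x), with convergence in L_2(-x, x) *)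
Definition legendre_expansion (x : R) (p : nat -> nat) (F : R -> C)
    (c : nat -> C) : Prop :=
  (\int[mu]_(t in `](- x)%R, x[)
     (Normc.normc (F t - legendre_partial_sum x p c m t)%R ^+ 2)%:E)%E
  @[m --> \oo] --> 0%E.

Definition cosine_kernel (K : R -> R -> C) (x t : R) : C := K x t + K x (- t).
Definition sine_kernel (K : R -> R -> C) (x t : R) : C := K x t - K x (- t).

End FourierLegendre.

(* Main.v *)
Require Import Defs.
From mathcomp Require Import all_boot all_order all_algebra.
From mathcomp Require Import all_classical all_reals all_analysis.
From mathcomp Require Import measurable_realfun ring lra.

Set Implicit Arguments.
Unset Strict Implicit.
Unset Printing Implicit Defensive.
Import Order.TTheory GRing.Theory Num.Theory.
Import numFieldNormedType.Exports.
Local Open Scope classical_set_scope.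
Local Open Scope ring_scope.
Local Open Scope complex_scope.

(** Everything comes down to the moments of the kernel,

      int_{-x}^{x} K(x,t) t^k dt = phi^(k)(x) - x^k.

    The coefficient a_n pairs K(x,.) with P_n(./x), so it is a combination of
    moments; the terms x^k contribute P_n(1) = 1, and what remains is the stated
    sum ([a_coef_of_moments]). Since P_n has the parity of n, half of the terms
    vanish for g_n and s_n ([legendre_parity]). That a_n, g_n and s_n are the
    only possible coefficients of L2 expansions is orthogonality of the Legendre
    polynomials together with the value of their norms
    ([legendre_expansion_coef], [legendre_norm]); for the cosine and sine
    kernels one also reflects t to -t ([Cintegral_opp], [legendre_opp]).

    For the moments ([moments]), put i rho = s with s real and small in

      e(rho,x) = exp(i rho x) + int_{-x}^{x} K(x,t) exp(i rho t) dt.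

    The exponentials become real, and Taylor's formula ([expR_taylor]) expands
    the right-hand side in powers of s, with the moments of K over k! as the
    coefficients contributed by the integral. If the left-hand side has an
    expansion as well, the two can be compared, for a polynomial that is small
    to an order above its degree is zero ([Cpoly_small_eq0]). On the left, let
    v = e/f. The Wronskian W = f e' - e f' satisfies W' = s^2 f e between nodes,
    because e and f solve equations with the same potential and with spectral
    parameters -s^2 and 0. It is continuous across the nodes although e' and f'
    are not, because their jumps are alpha e and alpha f with the same alpha. As
    W(0) = s and v' = W/f^2, the point interactions disappear from the equation
    for v ([quotient_volterra]):

      v(x) = 1 + int_0^x f^{-2}(y) (s + s^2 int_0^y f^2 v) dy.

    Iterating it gives the expansion of v in powers of s, and the recursion that
    defines the formal powers says that its coefficients are phi^(k)/(f k!)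
    ([volterra_expansion]).

    The Wronskian argument needs derivatives in the classical sense, while
    solutions are given by weak derivatives in H^2. A continuous function with
    an integrable weak second derivative w is, up to an affine function, the
    double primitive of w ([weak_second_derivative_primitive]). Hence it is C^1
    up to the ends of each interval and its derivative is a primitive of w,
    which is what is needed to differentiate the Wronskian under the integral
    sign ([Cintegration_by_parts], [wronskian_piece]). *)
(** * Integration by parts against an integrable factor *)
Section RealIntegrals.
Context {R : realType}.
Local Notation mu := (@lebesgue_measure R).
Implicit Types (f g F G : R -> R) (a b t x : R).

Lemma continuous_bounded f a b : {within `[a, b], continuous f} ->
  exists2 M : R, 0 <= M & forall t, t \in `[a, b] -> `|f t| <= M.
Proof.
move=> cf; have [ab|ba] := leP a b; last first.
  by exists 0 => // t; rewrite in_itv/= => /andP[at_ tb]; move: (le_trans at_ tb); rewrite leNgt ba.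
have cnf : {within `[a, b], continuous (fun t => `|f t|)}.
  by move=> t; apply: cvg_norm; exact: cf.
have [c cab cmax] := EVT_max ab cnf.
by exists `|f c|.
Qed.

Lemma continuous_integrable f a b : {within `[a, b], continuous f} ->
  mu.-integrable `[a, b] (EFin \o f).
Proof. by move=> cf; apply: continuous_compact_integrable => //; exact: segment_compact. Qed.

Lemma continuous_measurable f a b : {within `[a, b], continuous f} ->
  measurable_fun `[a, b] f.
Proof. by move=> cf; exact: subspace_continuous_measurable_fun. Qed.

Lemma integrable_measurable f (A : set R) : mu.-integrable A (EFin \o f) ->
  measurable_fun A f.
Proof. by move=> /measurable_int /measurable_EFinP. Qed.

Lemma Rintegrable_add f g (A : set R) : measurable A ->
  mu.-integrable A (EFin \o f) -> mu.-integrable A (EFin \o g) ->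
  mu.-integrable A (EFin \o (fun t => f t + g t)).
Proof. by move=> mA fi gi; have := @integrableD _ _ _ mu _ mA _ _ fi gi. Qed.

Lemma Rintegrable_sub f g (A : set R) : measurable A ->
  mu.-integrable A (EFin \o f) -> mu.-integrable A (EFin \o g) ->
  mu.-integrable A (EFin \o (fun t => f t - g t)).
Proof. by move=> mA fi gi; have := @integrableB _ _ _ mu _ mA _ _ fi gi. Qed.

Lemma Rintegrable_scale f (A : set R) c : measurable A ->
  mu.-integrable A (EFin \o f) -> mu.-integrable A (EFin \o (fun t => c * f t)).
Proof. by move=> mA fi; have := @integrableZl _ _ _ mu _ mA c _ fi. Qed.

Lemma integrableM_bounded f g (A : set R) M : measurable A ->
  measurable_fun A f -> (forall t, A t -> `|f t| <= M) ->
  mu.-integrable A (EFin \o g) -> mu.-integrable A (EFin \o (fun t => f t * g t)).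
Proof.
move=> mA mf fM ig; have mg := integrable_measurable ig.
apply: (@le_integrable _ _ _ mu _ mA _ (fun t => (M * g t)%:E)).
- by apply/measurable_EFinP; exact: measurable_funM.
- move=> t At /=; rewrite lee_fin !normrM ler_wpM2r//.
  by rewrite (le_trans (fM _ At))// ler_norm.
- exact: Rintegrable_scale.
Qed.

Lemma integrableM_continuous f g a b : {within `[a, b], continuous f} ->
  mu.-integrable `[a, b] (EFin \o g) ->
  mu.-integrable `[a, b] (EFin \o (fun t => f t * g t)).
Proof.
move=> cf ig; have [M _ fM] := continuous_bounded cf.
apply: (@integrableM_bounded f g _ M) => //; exact: continuous_measurable.
Qed.

Lemma integrable_itvS f a b c d : a <= c -> d <= b ->
  mu.-integrable `[a, b] (EFin \o f) -> mu.-integrable `[c, d] (EFin \o f).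
Proof.
move=> ac db; apply: integrableS => //.
by apply: subset_itvScc.
Qed.

Lemma integral_derive f F a b : a <= b -> {within `[a, b], continuous F} ->
  {within `[a, b], continuous f} ->
  (forall t, t \in `]a, b[ -> is_derive t 1 F (f t)) ->
  \int[mu]_(t in `[a, b]) f t = F b - F a.
Proof.
rewrite le_eqVlt => /predU1P[<- _ _ _|ab cF cf dF].
  by rewrite set_itv1 Rintegral_set1 subrr.
rewrite /Rintegral (@continuous_FTC2 _ f F)//.
- have [_ Fa Fb] := (continuous_within_itvP _ ab).1 cF.
  by split => // t /dF[].
- by move=> t /dF d; rewrite derive1E derive_val.
Qed.

Lemma primitive_continuous f a b : a <= b -> mu.-integrable `[a, b] (EFin \o f) ->
  {within `[a, b], continuous (fun t => \int[mu]_(s in `[a, t]) f s)}.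
Proof. exact: parameterized_integral_continuous. Qed.

Lemma primitive_derive f a b t : {within `[a, b], continuous f} -> t \in `]a, b[ ->
  is_derive t 1 (fun t => \int[mu]_(s in `[a, t]) f s) (f t).
Proof.
move=> cf tab; move: (tab); rewrite in_itv/= => /andP[at_ tb].
have ab := lt_trans at_ tb.
have [|d1 d2] := @continuous_FTC1_closed _ f a t b tb (continuous_integrable cf) at_.
  exact: within_continuous_continuous tab.
by split => //; rewrite -derive1E.
Qed.

Lemma le_normr_integral f a b M : a <= b -> mu.-integrable `[a, b] (EFin \o f) ->
  (forall t, t \in `[a, b] -> `|f t| <= M) ->
  `|\int[mu]_(t in `[a, b]) f t| <= M * (b - a).
Proof.
move=> ab fi fM; apply: (le_trans (le_normr_Rintegral _ fi)) => //.
have -> : M * (b - a) = \int[mu]_(t in `[a, b]) M.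
  by rewrite Rintegral_cst//= lebesgue_measure_itv/= lte_fin; case: ltP => //= ba;
    rewrite (@le_anti _ _ a b) ?ab ?ba ?subrr ?mulr0.
apply: le_Rintegral => //.
- by have := integrable_norm fi.
- apply: measurable_bounded_integrable => //.
    by rewrite /= lebesgue_measure_itv/= lte_fin; case: ifP => // _; rewrite -EFinB ltry.
  by exists `|M|; split => // N /ltW ? ? _ /=.
Qed.

Lemma le_normr_primitive f a b t : t \in `[a, b] -> mu.-integrable `[a, b] (EFin \o f) ->
  `|\int[mu]_(s in `[a, t]) f s| <= \int[mu]_(s in `[a, b]) `|f s|.
Proof.
rewrite in_itv/= => /andP[at_ tb] fi.
have fit := integrable_itvS (lexx a) tb fi.
apply: (le_trans (le_normr_Rintegral _ fit)) => //.
have := integrable_norm fi => fin; have := integrable_norm fit => fint.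
rewrite /Rintegral fine_le//; try exact: integrable_fin_num.
apply: ge0_subset_integral => //=.
- exact: (measurable_int mu).
- by apply: subset_itvScc.
Qed.

(** The fundamental theorem gives this for continuous [g]; both sides are
    continuous in [g] for the norm of L1, where continuous functions are dense. *)
Lemma integration_by_parts_L1 F f g a b c : a <= b ->
  {within `[a, b], continuous F} -> {within `[a, b], continuous f} ->
  (forall t, t \in `]a, b[ -> is_derive t 1 F (f t)) ->
  mu.-integrable `[a, b] (EFin \o g) ->
  let G t := c + \int[mu]_(s in `[a, t]) g s in
  \int[mu]_(t in `[a, b]) (f t * G t + F t * g t) = F b * G b - F a * c.
Proof.
move=> ab cF cf dF ig G.
have smooth_case h : {within `[a, b], continuous h} ->
  let H t := c + \int[mu]_(s in `[a, t]) h s in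
  \int[mu]_(t in `[a, b]) (f t * H t + F t * h t) = F b * H b - F a * c.
  move=> ch H.
  have cH : {within `[a, b], continuous H}.
    move=> t; apply: cvgD; first exact: cvg_cst.
    exact: (primitive_continuous ab (continuous_integrable ch)).
  transitivity (F b * H b - F a * H a); last first.
    by rewrite {2}/H set_itv1 Rintegral_set1 addr0.
  apply: (@integral_derive _ (fun t => F t * H t)) => //.
  - by move=> t; apply: cvgM; [exact: cF|exact: cH].
  - move=> t; apply: cvgD; first by apply: cvgM; [exact: cf|exact: cH].
    by apply: cvgM; [exact: cF|exact: ch].
  - move=> t tab; have dF' := dF _ tab.
    have dI := primitive_derive ch tab.
    have dH : is_derive t 1 H (0 + h t) by exact: (@is_deriveD _ _ _ (cst c)).
    rewrite add0r in dH.
    apply: is_derive_eq; rewrite /= /GRing.scale/= addrC.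
    by congr (_ + _); rewrite mulrC.
have [M M0 FM] := continuous_bounded cF; have [m m0 fm] := continuous_bounded cf.
have cG : {within `[a, b], continuous G}.
  by move=> t; apply: cvgD; [exact: cvg_cst|exact: (primitive_continuous ab ig)].
have mfin : (mu `[a, b] < +oo)%E.
  by rewrite lebesgue_measure_itv/= lte_fin; case: ifP => // _; rewrite -EFinB ltry.
have [g_ [cg_ ig_ g_cvg]] := approximation_continuous_integrable
  (measurable_itv `[a, b]) mfin ig.
apply/eqP; rewrite -subr_eq0 -normr_eq0 eq_le normr_ge0 andbT.
apply/ler_addgt0Pl => e e0; rewrite addr0.
(* The estimate below multiplies the L1 distance of [g] and [h] by at most
   m (b - a) + M + M; the final 1 keeps the divisor positive. *)
pose C := m * (b - a) + M + M + 1.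
have C0 : 0 < C by rewrite ltr_wpDl// !addr_ge0// mulr_ge0// subr_ge0.
have : \forall n \near \oo, (\int[mu]_(z in `[a, b]) `|(g z - g_ n z)%:E| < (e / C)%:E)%E.
  apply: (g_cvg (fun u => (u < (e / C)%:E)%E)); apply: open_ereal_lt'.
  by rewrite lte_fin divr_gt0.
move=> [n _ /(_ n (leqnn n)) /= small].
have ch : {within `[a, b], continuous (g_ n)} by apply: continuous_subspaceT => t; exact: cg_.
have {smooth_case} := smooth_case _ ch; move: small; set h := g_ n => small.
set H := fun t => c + _ => hE.
have ih := continuous_integrable ch.
have id : mu.-integrable `[a, b] (EFin \o (fun t => g t - h t)).
  exact: Rintegrable_sub.
have idn := integrable_norm id.
pose d := \int[mu]_(t in `[a, b]) `|g t - h t|.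
have dsmall : d < e / C.
  rewrite -lte_fin /d /Rintegral fineK//; last exact: integrable_fin_num.
have GH t : t \in `[a, b] -> G t - H t = \int[mu]_(s in `[a, t]) (g s - h s).
  rewrite in_itv/= => /andP[at_ tb]; rewrite RintegralB//; last 2 first.
  - exact: integrable_itvS tb ig.
  - exact: integrable_itvS tb ih.
  by rewrite /G /H opprD addrACA subrr add0r.
have GHd t : t \in `[a, b] -> `|G t - H t| <= d.
  by move=> tab; rewrite GH//; exact: le_normr_primitive.
have cH : {within `[a, b], continuous H}.
  by move=> t; apply: cvgD; [exact: cvg_cst|exact: (primitive_continuous ab ih)].
have cGH : {within `[a, b], continuous (fun t => f t * (G t - H t))}.
  by move=> t; apply: cvgM; [exact: cf|apply: cvgB; [exact: cG|exact: cH]].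
have iF := integrableM_continuous cF.
have iall k K : {within `[a, b], continuous K} -> mu.-integrable `[a, b] (EFin \o k) ->
    mu.-integrable `[a, b] (EFin \o (fun t => f t * K t + F t * k t)).
  move=> cK ik; apply: Rintegrable_add => //; last exact: iF.
  apply: continuous_integrable => t; apply: cvgM; [exact: cf|exact: cK].
have -> : \int[mu]_(t in `[a, b]) (f t * G t + F t * g t) - (F b * G b - F a * c) =
    \int[mu]_(t in `[a, b]) (f t * (G t - H t)) +
    \int[mu]_(t in `[a, b]) (F t * (g t - h t)) - F b * (G b - H b).
  rewrite -RintegralD//; last 2 first.
  - exact: continuous_integrable.
  - exact: iF.
  have -> : \int[mu]_(t in `[a, b]) (f t * (G t - H t) + F t * (g t - h t)) =
      \int[mu]_(t in `[a, b]) (f t * G t + F t * g t) -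
      \int[mu]_(t in `[a, b]) (f t * H t + F t * h t).
    rewrite -RintegralB//; [|exact: iall..].
    by apply: eq_Rintegral => t _; ring.
  by rewrite hE; ring.
have bab : b \in `[a, b] by rewrite in_itv/= ab lexx.
apply: (le_trans (ler_normB _ _)).
have -> : e = m * (b - a) * (e / C) + M * (e / C) + M * (e / C) + e / C.
  by rewrite -!mulrDl -[X in _ + X]mul1r -mulrDl mulrC divfK// gt_eqF.
apply: (@le_trans _ _ (m * (b - a) * (e / C) + M * (e / C) + M * (e / C))); last first.
  by rewrite lerDl divr_ge0// ltW.
rewrite lerD//; last first.
  by rewrite normrM ler_pM// ?FM// (le_trans (GHd _ bab))// ltW.
apply: (le_trans (ler_normD _ _)); rewrite lerD//.
- rewrite mulrAC; apply: le_normr_integral => //.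
    exact: continuous_integrable.
  by move=> t tab; rewrite normrM ler_pM// ?fm// (le_trans (GHd _ tab))// ltW.
- apply: (le_trans (le_normr_Rintegral _ (iF _ id))) => //.
  rewrite (@le_trans _ _ (M * d))//; last by rewrite ler_wpM2l// ltW.
  rewrite /d -RintegralZl//; apply: le_Rintegral => //.
  + by have := integrable_norm (iF _ id).
  + exact: Rintegrable_scale.
  + by move=> t tab; rewrite normrM ler_wpM2r// FM.
Qed.

End RealIntegrals.

(** * A smooth ramp *)
Section SmoothStep.
Context {R : realType}.
Implicit Types (f g : R -> R) (n : nat) (p : {poly R}).

(** Differentiability of order [n] in recursive form, so that stability under
    sums, products and quotients is an induction whose step is the Leibniz rule. *)
Fixpoint Ck n f : Prop :=
  if n is m.+1 then (forall x : R, derivable f x 1) /\ Ck m f^`()%classic else True.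

Lemma Ck_derivable n f : Ck n.+1 f -> forall x : R, derivable (derive1n n f) x 1.
Proof.
elim: n f => [f []//|n IH f [_ h] x].
by have := IH _ h x; rewrite derive1Sn.
Qed.

Lemma CkW n f : Ck n.+1 f -> Ck n f.
Proof. by elim: n f => // n IH f [df h]; split => //; exact: IH. Qed.

Lemma derive1_funext f (df : R -> R) : (forall x : R, is_derive x 1 f (df x)) ->
  f^`()%classic = df.
Proof. by move=> h; apply/funext => x; rewrite derive1E; have d := h x; rewrite derive_val. Qed.

Lemma derivable_is_derive1 f : (forall x : R, derivable f x 1) ->
  forall x : R, is_derive x 1 f (f^`()%classic x).
Proof. by move=> df x; rewrite derive1E; exact/derivableP. Qed.

Lemma CkS n f (df : R -> R) : (forall x : R, is_derive x 1 f (df x)) -> Ck n df -> Ck n.+1 f.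
Proof.
move=> h Cdf; split; first by move=> x; have [] := h x.
by rewrite (derive1_funext h).
Qed.

Lemma Ck_cst n (c : R) : Ck n (cst c).
Proof.
elim: n c => // n IH c; apply: (@CkS n _ (cst 0)); last exact: IH.
Qed.

Lemma CkD n f g : Ck n f -> Ck n g -> Ck n (fun x => f x + g x).
Proof.
elim: n f g => // n IH f g [/derivable_is_derive1 df cf] [/derivable_is_derive1 dg cg].
apply: CkS (IH _ _ cf cg).
Qed.

Lemma CkM n f g : Ck n f -> Ck n g -> Ck n (fun x => f x * g x).
Proof.
elim: n f g => // n IH f g cf cg.
have [/derivable_is_derive1 df cf'] := cf; have [/derivable_is_derive1 dg cg'] := cg.
apply: CkS (CkD (IH _ _ (CkW cf) cg') (IH _ _ (CkW cg) cf')).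
Qed.

Lemma CkZ n c f : Ck n f -> Ck n (fun x => c * f x).
Proof. by move=> cf; apply: CkM => //; exact: Ck_cst. Qed.

Lemma CkV n f : (forall x, f x != 0) -> Ck n f -> Ck n (fun x => (f x)^-1).
Proof.
move=> f0; elim: n => // n IH cf; have [/derivable_is_derive1 df cf'] := cf.
have cV := IH (CkW cf).
apply: CkS (CkZ (-1) (CkM (CkM cV cV) cf')) => x.
have dfx := df x.
have -> : -1 * ((f x)^-1 / f x * f^`()%classic x) = - f x ^- 2 *: f^`()%classic x.
  by rewrite /GRing.scale/= mulN1r mulNr -invfM expr2.
exact: is_deriveV.
Qed.

Lemma Ck_affine n f (c d : R) : Ck n f -> Ck n (fun x => f (c * x + d)).
Proof.
elim: n f => // n IH f [/derivable_is_derive1 df cf].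
apply: CkS (CkZ c (IH _ cf)) => x.
have dl : is_derive x 1 (fun x => c * x + d) c.
  apply/is_derive1_caratheodory; exists (cst c); split => //; first by move=> z /=; ring.
  exact: cvg_cst.
have dfx := df (c * x + d).
by have := @is_derive1_comp _ f (fun x => c * x + d) _ _ _ dfx dl; rewrite mulrC.
Qed.

(** The class of these functions is stable under differentiation, for the
    derivative of p(1/t)exp(-1/t) is q(1/t)exp(-1/t) with q = X^2(p - p'). *)
Definition flat p (t : R) : R := if 0 < t then p.[t^-1] * expR (- t^-1) else 0.

(** Each power is at most a factorial times the exponential, being a term of its
    series. This is what makes [flat] vanish at 0 to every order. *)
Lemma horner_le_expR p : exists2 C : R, 0 <= C & forall s : R, 0 < s -> `|p.[s]| <= C * expR s.
Proof.
exists (\sum_(i < size p) `|p`_i| * i`!%:R).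
  by apply: sumr_ge0 => i _; rewrite mulr_ge0.
move=> s s0; rewrite horner_coef mulr_suml (le_trans (ler_norm_sum _ _ _))//.
apply: ler_sum => i _; rewrite normrM -mulrA ler_wpM2l// (ger0_norm (exprn_ge0 _ (ltW s0))).
case: (nat_of_ord i) => [|k].
  by rewrite expr0 fact0 mul1r -expR0 ler_expR ltW.
rewrite mulrC -ler_pdivrMr ?ltr0n ?fact_gt0//.
by rewrite (le_trans _ (expR_ge1Dxn k (ltW s0)))// lerDr.
Qed.

Lemma flat_le_sqr p : exists2 C : R, 0 <= C & forall t, `|flat p t| <= C * t ^+ 2.
Proof.
have [C C0 pC] := horner_le_expR ('X^2 * p); exists C => // t; rewrite /flat.
case: ifPn => [t0|_]; last by rewrite normr0 mulr_ge0// sqr_ge0.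
have ti : 0 < t^-1 by rewrite invr_gt0.
have := pC _ ti; rewrite hornerM hornerXn !normrM => h.
rewrite (ger0_norm (expR_ge0 _)) expRN ler_pdivrMr ?expR_gt0//.
rewrite mulrAC -ler_pdivrMr ?exprn_gt0// mulrC.
by move: h; rewrite -normrM -expr2 exprVn ger0_norm// invr_ge0 exprn_ge0// ltW.
Qed.

(** Away from 0 this is the product rule. At 0 the quadratic bound gives the
    derivative 0 for every [p] at once, so no induction on the order is needed. *)
Lemma is_derive_flat p (t : R) : is_derive t 1 (flat p) (flat ('X^2 * (p - p^`())) t).
Proof.
have [t0|t0|->] := ltgtP t 0.
- rewrite {2}/flat ltNge (ltW t0)/=.
  have d0 : is_derive t 1 (cst 0 : R -> R) 0 by exact: is_derive_cst.
  apply: near_eq_is_derive d0.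
  near=> s; have s0 : s < 0 by near: s; exact: lt_nbhsl.
  by rewrite /flat ltNge (ltW s0).
- rewrite {2}/flat t0.
  have tn : t != 0 by rewrite gt_eqF.
  have dV : is_derive t 1 (fun s : R => s^-1) (- t ^- 2 *: 1).
    exact: (@is_deriveV _ id).
  have dp : is_derive (t^-1) 1 (horner p) (p^`().[t^-1]).
    split; first exact: derivable_horner.
    by rewrite -derive1E -derivE.
  have de : is_derive (- t^-1) 1 (@expR R) (expR (- t^-1)) by exact: is_derive_expR.
  have dN : is_derive t 1 (fun s : R => - s^-1) (- (- t ^- 2 *: 1)) by exact: is_deriveN.
  have d1 := is_derive1_comp dp dV.
  have d2 := @is_derive1_comp _ _ (fun s : R => - s^-1) _ _ _ de dN.
  have d12 := is_deriveM d1 d2.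
  have -> : ('X^2 * (p - p^`())).[t^-1] * expR (- t^-1) =
    (horner p \o GRing.inv) t *: (expR (- t^-1) * - (- t ^- 2 *: 1)) +
    (expR \o (fun s : R => - s^-1)) t *: (p^`().[t^-1] * (- t ^- 2 *: 1)).
    by rewrite /GRing.scale/= !(hornerM, hornerXn, hornerD, hornerN, hornerX); field.
  apply: near_eq_is_derive d12.
  near=> s; have s0 : 0 < s by near: s; exact: lt_nbhsr.
  by rewrite /flat s0.
- rewrite {2}/flat ltxx; have [C C0 pC] := flat_le_sqr p.
  apply/is_derive1_caratheodory; exists (fun s => flat p s / s); split.
  + move=> s; rewrite {2}/flat ltxx !subr0.
    have [->|s0] := eqVneq s 0; last by rewrite divfK.
    by rewrite mulr0 /flat ltxx.
  + apply/cvgrPdist_le => /= e e0; rewrite invr0 mulr0.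
    near=> s; rewrite sub0r normrN normrM normfV.
    have [->|s0] := eqVneq s 0; first by rewrite normr0 invr0 mulr0 ltW.
    rewrite ler_pdivrMr ?normr_gt0// (le_trans (pC s))// -real_normK ?num_real//.
    rewrite expr2 mulrA ler_wpM2r//.
    have : `|s| <= e / (C + 1).
      rewrite -[s]subr0 distrC; near: s; apply: (@cvgr_dist_le _ _ _ _ _ id 0) => //.
      by rewrite divr_gt0// ltr_wpDl.
    rewrite ler_pdivlMr ?ltr_wpDl// => /(le_trans _); apply.
    by rewrite mulrC ler_wpM2l// lerDl.
  + by rewrite invr0 mulr0.
Unshelve. all: by end_near. Qed.

Lemma Ck_flat n p : Ck n (flat p).
Proof. by elim: n p => // n IH p; apply: CkS (IH _) => t; exact: is_derive_flat. Qed.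

Lemma Ck_id n : Ck n (fun x : R => x).
Proof.
case: n => // n; apply: (@CkS n _ (cst 1)); last exact: Ck_cst.
Qed.

Lemma flat1_ge0 t : 0 <= flat 1 t.
Proof. by rewrite /flat; case: ifP => // _; rewrite hornerC mul1r expR_ge0. Qed.

Lemma flat1_gt0 t : 0 < t -> 0 < flat 1 t.
Proof. by rewrite /flat => ->; rewrite hornerC mul1r expR_gt0. Qed.

(** The product of t and a smooth step from 0 to 1. *)
Lemma smooth_ramp_exists : exists J : R -> R, [/\ forall n, Ck n J,
  forall t, t <= 0 -> J t = 0 & forall t, 1 <= t -> J t = t].
Proof.
pose D t := flat 1 t + flat 1 (-1 * t + 1).
have D0 t : D t != 0.
  rewrite gt_eqF// /D; have [t0|t0] := ltP 0 t.
    by rewrite ltr_pwDl ?flat1_gt0 ?flat1_ge0.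
  by rewrite ltr_wpDl ?flat1_ge0// flat1_gt0// mulN1r (addrC (- t)) subr_gt0 (le_lt_trans t0).
exists (fun t => t * (flat 1 t * (D t)^-1)); split.
- move=> n; apply: CkM; first exact: Ck_id.
  apply: CkM; first exact: Ck_flat.
  by apply: CkV => //; apply: CkD; [|apply: Ck_affine]; exact: Ck_flat.
- by move=> t t0; rewrite {1}/flat ltNge t0 mul0r mulr0.
- move=> t t1; have t0 : 0 < t by rewrite (lt_le_trans _ t1).
  have -> : D t = flat 1 t.
    by rewrite /D {2}/flat mulN1r (addrC (- t)) subr_gt0 ltNge t1 addr0.
  by rewrite divff ?mulr1// gt_eqF// flat1_gt0.
Qed.

End SmoothStep.

(** * Functions with an integrable weak second derivative *)
Section WeakSecondDerivative.
Context {R : realType}.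
Local Notation mu := (@lebesgue_measure R).
Implicit Types (u w g phi : R -> R) (a b t p e : R).

Lemma Rintegral_itv_oo_cc g a b : mu.-integrable `[a, b] (EFin \o g) ->
  \int[mu]_(t in `]a, b[) g t = \int[mu]_(t in `[a, b]) g t.
Proof.
move=> ig.
rewrite Rintegral_itv_bndo_bndc; last first.
  by apply: integrableS ig => //; exact: subset_itv_oo_cc.
rewrite Rintegral_itv_obnd_cbnd//.
by apply: integrableS ig => //; exact: subset_itv_oc_cc.
Qed.

Lemma Rintegral_lin3 (f1 f2 f3 : R -> R) (c1 c2 c3 : R) (A : set R) : measurable A ->
  mu.-integrable A (EFin \o f1) -> mu.-integrable A (EFin \o f2) ->
  mu.-integrable A (EFin \o f3) ->
  \int[mu]_(t in A) (c1 * f1 t + c2 * f2 t + c3 * f3 t) =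
  c1 * \int[mu]_(t in A) f1 t + c2 * \int[mu]_(t in A) f2 t + c3 * \int[mu]_(t in A) f3 t.
Proof.
move=> mA i1 i2 i3.
have j1 := Rintegrable_scale c1 mA i1; have j2 := Rintegrable_scale c2 mA i2.
have j3 := Rintegrable_scale c3 mA i3; have j12 := Rintegrable_add mA j1 j2.
by rewrite RintegralD// RintegralD// !RintegralZl.
Qed.

Lemma derivable1_continuous (f : R -> R) : (forall x : R, derivable f x 1) -> continuous f.
Proof. by move=> df x; apply: differentiable_continuous; apply/derivable1_diffP. Qed.

Lemma test_function_derive a b phi : test_function a b phi ->
  test_function a b (derive1 phi).
Proof.
move=> [dphi [c [d [ac db phi0]]]]; split.
  by move=> n x; have := dphi n.+1 x; rewrite derive1Sn.
exists c, d; split=> // x xcd.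
rewrite derive1E.
suff h : is_derive x 1 phi 0 by rewrite derive_val.
have d0 : is_derive x 1 (cst 0 : R -> R) 0 by exact: is_derive_cst.
apply: near_eq_is_derive d0.
move: xcd; rewrite negb_and -!ltNge => /orP[xc|dx].
- near=> y; rewrite phi0// negb_and -ltNge; apply/orP; left.
  by near: y; exact: lt_nbhsl.
- near=> y; rewrite phi0// negb_and -!ltNge; apply/orP; right.
  by near: y; exact: lt_nbhsr.
Unshelve. all: by end_near. Qed.

Lemma test_function_eq0 a b phi t : test_function a b phi -> t <= a \/ b <= t -> phi t = 0.
Proof.
move=> [_ [c [d [ac db phi0]]]] tab; apply: phi0; rewrite negb_and -!ltNge.
by case: tab => h; apply/orP; [left; apply: le_lt_trans ac|right; apply: lt_le_trans h].
Qed.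

Lemma test_function_is_derive a b phi : test_function a b phi ->
  forall t : R, is_derive t 1 phi (derive1 phi t).
Proof. by move=> [dphi _] t; rewrite derive1E; apply/derivableP; exact: (dphi 0%N). Qed.

Lemma test_function_continuous a b phi : test_function a b phi -> continuous phi.
Proof. by move=> [dphi _]; apply: derivable1_continuous => x; exact: (dphi 0%N). Qed.

Section Ramp.
Variables J : R -> R.
Hypothesis J_Ck : forall n, Ck n J.
Hypothesis J_le0 : forall t, t <= 0 -> J t = 0.
Hypothesis J_ge1 : forall t, 1 <= t -> J t = t.

Let J1 : R -> R := derive1 J.
Let J2 : R -> R := derive1 J1.

Let dJ t : is_derive t 1 J (J1 t).
Proof. by apply: derivable_is_derive1; have [] := J_Ck 1. Qed.

Let dJ1 t : is_derive t 1 J1 (J2 t).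
Proof. by apply: derivable_is_derive1; have [_ []] := J_Ck 2. Qed.

Let J2_cont : continuous J2.
Proof. by apply: derivable1_continuous; have [_ [_ []]] := J_Ck 3. Qed.

Let J1_lt0 t : t < 0 -> J1 t = 0.
Proof.
move=> t0; rewrite /J1 derive1E.
suff h : is_derive t 1 J 0 by rewrite derive_val.
have d0 : is_derive t 1 (cst 0 : R -> R) 0 by exact: is_derive_cst.
apply: near_eq_is_derive d0; near=> s; rewrite J_le0//.
by apply/ltW; near: s; exact: lt_nbhsl.
Unshelve. all: by end_near. Qed.

Let J1_gt1 t : 1 < t -> J1 t = 1.
Proof.
move=> t1; rewrite /J1 derive1E.
suff h : is_derive t 1 J 1 by rewrite derive_val.
have d1 : is_derive t 1 (id : R -> R) 1 by exact: is_derive_id.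
apply: near_eq_is_derive d1; near=> s; rewrite J_ge1//.
by apply/ltW; near: s; exact: lt_nbhsr.
Unshelve. all: by end_near. Qed.

Let J2_out t : t < 0 \/ 1 < t -> J2 t = 0.
Proof.
move=> t0; rewrite /J2 derive1E.
suff h : is_derive t 1 J1 0 by rewrite derive_val.
case: t0 => h.
- have d0 : is_derive t 1 (cst 0 : R -> R) 0 by exact: is_derive_cst.
  apply: near_eq_is_derive d0; near=> s; rewrite J1_lt0//.
  by near: s; exact: lt_nbhsl.
- have d0 : is_derive t 1 (cst 1 : R -> R) 0 by exact: is_derive_cst.
  apply: near_eq_is_derive d0; near=> s; rewrite J1_gt1//.
  by near: s; exact: lt_nbhsr.
Unshelve. all: by end_near. Qed.

Let J2_bounded : exists2 B : R, 0 <= B & forall t, `|J2 t| <= B.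
Proof.
have [B B0 JB] := continuous_bounded (continuous_subspaceT (A := `[0, 1]%classic : set R) J2_cont).
exists B => // t; have [t0|t0] := ltP t 0; first by rewrite J2_out ?normr0//; left.
have [t1|t1] := ltP 1 t; first by rewrite J2_out ?normr0//; right.
by apply: JB; rewrite in_itv/= t0.
Qed.

Let sc e p t := e^-1 * t + - (e^-1 * p).

Let scE e p t : sc e p t = (t - p) / e.
Proof. by rewrite /sc -mulrBr mulrC. Qed.

Let sc_derive e p (F f : R -> R) : (forall t : R, is_derive t 1 F (f t)) ->
  forall t : R, is_derive t 1 (fun t => F (sc e p t)) (e^-1 * f (sc e p t)).
Proof.
move=> dF t.
have dl : is_derive t 1 (sc e p) (e^-1).
  apply/is_derive1_caratheodory; exists (cst e^-1); split => //.
    by move=> z; rewrite /sc /=; ring.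
  exact: cvg_cst.
have dFx := dF (sc e p t).
by have := is_derive1_comp dFx dl; rewrite mulrC.
Qed.

(** The derivative of the ramp rises from 0 to 1, so the rescaled second
    derivative has integral 1 and support in [p, p + e]. It may change sign, which
    is why the bound on it enters the choice of [e]. *)
Let approximate_identity g a b p : {within `[a, b], continuous g} -> a < p < b ->
  forall del : R, 0 < del -> exists2 e0 : R, 0 < e0 & forall e, 0 < e < e0 ->
    `|\int[mu]_(t in `[a, b]) (g t * (e^-1 * J2 (sc e p t))) - g p| <= del.
Proof.
move=> cg /andP[ap pb] del del0; have [B B0 JB] := J2_bounded.
have ab := lt_trans ap pb.
have B1 : 0 < B + 1 by rewrite ltr_wpDl.
have cgp : {for p, continuous g}.
  by apply: within_continuous_continuous cg _ => //; rewrite in_itv/= ap.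
have /cvgrPdist_le/(_ (del / (B + 1))) := cgp.
(* Oscillation of [g] below del / (B + 1) is enough, since the kernel is bounded
   by B / e on an interval of length e. *)
rewrite divr_gt0// => /(_ isT) [r /= r0 gr].
exists (Num.min r (b - p)); first by rewrite lt_min r0 subr_gt0.
move=> e /andP[e0]; rewrite lt_min => /andP[er eb].
have ck : continuous (fun t => e^-1 * J2 (sc e p t)).
  move=> t; apply: cvgM; first exact: cvg_cst.
  apply: continuous_comp; last exact: J2_cont.
  by apply: cvgD; [apply: cvgM; [exact: cvg_cst|exact: cvg_id]|exact: cvg_cst].
have ckab := continuous_subspaceT (A := `[a, b]) ck.
have ik := continuous_integrable ckab.
have igk := integrableM_continuous cg ik.
have k1 : \int[mu]_(t in `[a, b]) (e^-1 * J2 (sc e p t)) = 1.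
  have dk := sc_derive e p dJ1.
  rewrite (@integral_derive _ _ (fun t => J1 (sc e p t)) _ _ (ltW ab) _ ckab)//; last first.
    apply: continuous_subspaceT; apply: derivable1_continuous => x.
    by have [] := dk x.
  rewrite J1_gt1 ?J1_lt0 ?subr0//.
    by rewrite scE pmulr_llt0 ?invr_gt0// subr_lt0.
  by rewrite scE ltr_pdivlMr// mul1r.
rewrite -[X in _ - X]mulr1 -k1 -RintegralZl// -RintegralB//; last first.
  exact: Rintegrable_scale.
rewrite (_ : \int[mu]_(t in _) _ =
    \int[mu]_(t in `[p, p + e]) ((g t - g p) * (e^-1 * J2 (sc e p t)))); last first.
  have /setIidr : `[p, p + e] `<=` `[a, b].
    by apply: subset_itvScc; rewrite bnd_simp; lra.
  move=> <-; rewrite Rintegral_mkcondr; apply: eq_Rintegral => t _.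
  rewrite patchE -mulrBl; case: ifPn => // tpe.
  rewrite J2_out ?mulr0// !scE.
  move: tpe; rewrite notin_setE/= in_itv/= => /negP; rewrite negb_and -!ltNge => /orP[h|h].
    by left; rewrite pmulr_llt0 ?invr_gt0// subr_lt0.
  by right; rewrite ltr_pdivlMr// mul1r; lra.
have pe : p <= p + e by rewrite lerDl ltW.
have := @le_normr_integral _ (fun t => (g t - g p) * (e^-1 * J2 (sc e p t))) p (p + e)
  (del / (B + 1) * (e^-1 * B)) pe.
have -> : del / (B + 1) * (e^-1 * B) * (p + e - p) = del * (B / (B + 1)).
  by field; rewrite !gt_eqF.
move=> h; apply: le_trans (h _ _) _.
- apply: continuous_integrable.
  have cg' : {within `[p, p + e], continuous g}.
    by apply: continuous_subspaceW cg; apply: subset_itvScc; rewrite bnd_simp; lra.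
  have ck' := continuous_subspaceT (A := `[p, p + e]) ck.
  move=> t; apply: cvgM; last exact: ck'.
  by apply: cvgB; [exact: cg'|exact: cvg_cst].
- move=> t; rewrite in_itv/= => /andP[pt tpe]; rewrite normrM ler_pM//.
    rewrite distrC; apply: gr => /=; rewrite ler0_norm; lra.
  rewrite normrM gtr0_norm ?invr_gt0// ler_wpM2l// invr_ge0; exact: ltW.
- rewrite ler_piMr ?(ltW del0)// ler_pdivrMr// mul1r; lra.
Qed.

Let three_point_bound (p m q gp gm gq x y z de c : R) : c != 0 ->
  p < m -> m < q -> 0 <= de ->
  c * (q - m) * x + c * - (q - p) * y + c * (m - p) * z = 0 ->
  `|x - gp| <= de -> `|y - gm| <= de -> `|z - gq| <= de ->
  `|(q - m) * gp + (m - p) * gq - (q - p) * gm| <= de * (2 * (q - p)).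
Proof.
move=> c0 pm mq de0 I0 Hp Hm Hq.
have qp : 0 < q - p by lra.
have {}I0 : (q - m) * x + - (q - p) * y + (m - p) * z = 0.
  by apply: (mulfI c0); rewrite mulr0 -I0; ring.
have -> : (q - m) * gp + (m - p) * gq - (q - p) * gm =
  - ((q - m) * (x - gp) + (m - p) * (z - gq) - (q - p) * (y - gm)).
  by rewrite -[LHS]subr0 -I0; ring.
rewrite normrN; apply: (le_trans (ler_normB _ _)).
apply: (@le_trans _ _ ((q - m) * de + (m - p) * de + (q - p) * de)); last lra.
rewrite lerD//; last by rewrite normrM gtr0_norm// ler_wpM2l// ltW.
apply: (le_trans (ler_normD _ _)).
by rewrite lerD// normrM gtr0_norm ?subr_gt0// ler_wpM2l// subr_ge0 ltW.
Qed.

(** A function annihilated by all second derivatives of test functions has zero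
    second divided differences. The test function is the second difference of
    mollified ramps starting at [p], [m] and [q]: to the right of all three the
    ramps are affine and the weights make the combination vanish, so it has
    compact support, and its second derivative approaches the combination of
    point masses at [p], [m] and [q]. *)
Let three_point a b g p m q : {within `[a, b], continuous g} ->
  (forall phi, test_function a b phi ->
    \int[mu]_(t in `[a, b]) (g t * derive1 (derive1 phi) t) = 0) ->
  a < p -> p < m -> m < q -> q < b ->
  (q - m) * g p + (m - p) * g q = (q - p) * g m.
Proof.
move=> cg g0 ap pm mq qb.
apply/eqP; rewrite -subr_eq0 -normr_eq0 eq_le normr_ge0 andbT.
apply/ler_addgt0Pl => del del0; rewrite addr0.
pose de := del / (2 * (q - p)).
have qp : 0 < q - p by lra.
have de0 : 0 < de by rewrite divr_gt0// mulr_gt0.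
have [|ep ep0 hp] := @approximate_identity _ _ _ p cg _ _ de0; first by apply/andP; split; lra.
have [|em em0 hm] := @approximate_identity _ _ _ m cg _ _ de0; first by apply/andP; split; lra.
have [|eq eq0 hq] := @approximate_identity _ _ _ q cg _ _ de0; first by apply/andP; split; lra.
(* Below [b - q] so that the support, which reaches up to [q + e], stays inside
   the interval; halved to make every inequality strict. *)
pose e := Num.min (Num.min ep em) (Num.min eq (b - q)) / 2.
have e2 : 0 < e * 2 by rewrite /e divfK// !lt_min ep0 em0 eq0 subr_gt0 qb.
have e0 : 0 < e by rewrite pmulr_lgt0 in e2.
have : e < e * 2 by lra.
rewrite {2}/e divfK// !lt_min => /andP[/andP[eep eem] /andP[eeq ebq]].
clearbody e; have en : e != 0 by rewrite gt_eqF.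
pose phi t := (q - m) * J (sc e p t) + - (q - p) * J (sc e m t) + (m - p) * J (sc e q t).
pose phi1 t := (q - m) * (e^-1 * J1 (sc e p t)) + - (q - p) * (e^-1 * J1 (sc e m t)) +
  (m - p) * (e^-1 * J1 (sc e q t)).
pose k r t := e^-1 * J2 (sc e r t).
pose phi2 t := (q - m) * (e^-1 * k p t) + - (q - p) * (e^-1 * k m t) +
  (m - p) * (e^-1 * k q t).
have lin (F1 F2 F3 f1 f2 f3 : R -> R) t :
    is_derive t 1 F1 (f1 t) -> is_derive t 1 F2 (f2 t) -> is_derive t 1 F3 (f3 t) ->
    is_derive t 1 (fun t => (q - m) * F1 t + - (q - p) * F2 t + (m - p) * F3 t)
      ((q - m) * f1 t + - (q - p) * f2 t + (m - p) * f3 t).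
  move=> d1 d2 d3.
  have e1 := @is_deriveZ _ _ _ F1 (q - m) _ _ _ d1.
  have e2' := @is_deriveZ _ _ _ F2 (- (q - p)) _ _ _ d2.
  have e3 := @is_deriveZ _ _ _ F3 (m - p) _ _ _ d3.
  exact: is_deriveD (is_deriveD e1 e2') e3.
have dphi t : is_derive t 1 phi (phi1 t).
  exact: (lin (fun t => J (sc e p t)) (fun t => J (sc e m t)) (fun t => J (sc e q t))
    (fun t => e^-1 * J1 (sc e p t)) (fun t => e^-1 * J1 (sc e m t))
    (fun t => e^-1 * J1 (sc e q t)) t (sc_derive e p dJ t) (sc_derive e m dJ t)
    (sc_derive e q dJ t)).
have scZ r F f : (forall t : R, is_derive t 1 F (f t)) -> forall t : R,
    is_derive t 1 (fun t => e^-1 * F (sc e r t)) (e^-1 * (e^-1 * f (sc e r t))).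
  by move=> dF t; have d := sc_derive e r dF t; exact: (@is_deriveZ _ _ _ _ e^-1 _ _ _ d).
have dphi1 t : is_derive t 1 phi1 (phi2 t).
  exact: (lin (fun t => e^-1 * J1 (sc e p t)) (fun t => e^-1 * J1 (sc e m t))
    (fun t => e^-1 * J1 (sc e q t)) (fun t => e^-1 * k p t) (fun t => e^-1 * k m t)
    (fun t => e^-1 * k q t) t (scZ p _ _ dJ1 t) (scZ m _ _ dJ1 t) (scZ q _ _ dJ1 t)).
have phi_test : test_function a b phi.
  split.
    move=> n x; apply: Ck_derivable.
    by apply: CkD; [apply: CkD|]; apply: CkZ; apply: Ck_affine.
  exists p, (q + e); split => //; first by lra.
  move=> t; rewrite negb_and -!ltNge /phi => /orP[tp|tq].
    rewrite !J_le0 ?mulr0 ?addr0// scE pmulr_lle0 ?invr_gt0//; lra.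
  rewrite !J_ge1 ?scE ?ler_pdivlMr ?mul1r//; try lra.
have ik r : mu.-integrable `[a, b] (EFin \o (fun t => g t * k r t)).
  apply: integrableM_continuous => //; apply: continuous_integrable.
  apply: continuous_subspaceT => t; apply: cvgM; first exact: cvg_cst.
  apply: continuous_comp; last exact: J2_cont.
  by apply: cvgD; [apply: cvgM; [exact: cvg_cst|exact: cvg_id]|exact: cvg_cst].
have H0 : \int[mu]_(t in `[a, b]) (g t * phi2 t) = 0.
  by have := g0 _ phi_test; rewrite (derive1_funext dphi) (derive1_funext dphi1).
have I0 : (e^-1 * (q - m)) * (\int[mu]_(t in `[a, b]) (g t * k p t)) +
    (e^-1 * - (q - p)) * (\int[mu]_(t in `[a, b]) (g t * k m t)) +
    (e^-1 * (m - p)) * (\int[mu]_(t in `[a, b]) (g t * k q t)) = 0.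
  rewrite -[RHS]H0; apply/esym.
  apply: etrans (Rintegral_lin3 _ _ _ (measurable_itv _) (ik p) (ik m) (ik q)).
  apply: eq_Rintegral => t _; rewrite /phi2.
  move: (k p t) (k m t) (k q t) (g t) (e^-1) => kp km kq gt c; ring.
have Hp := hp e; rewrite e0 eep in Hp; have {}Hp := Hp isT.
have Hm := hm e; rewrite e0 eem in Hm; have {}Hm := Hm isT.
have Hq := hq e; rewrite e0 eeq in Hq; have {}Hq := Hq isT.
apply: le_trans (three_point_bound (invr_neq0 en) pm mq (ltW de0) I0 Hp Hm Hq) _.
by rewrite /de divfK// mulf_neq0// gt_eqF.
Qed.

(** The line through the values at two fixed points, here at one and two thirds
    of the interval. *)
Let three_point_affine a b g : a < b ->
  (forall p m q, a < p -> p < m -> m < q -> q < b ->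
    (q - m) * g p + (m - p) * g q = (q - p) * g m) ->
  exists A B : R, forall t, a < t < b -> g t = A + B * t.
Proof.
move=> ab g3; pose p := a + (b - a) / 3; pose q := a + 2 * (b - a) / 3.
have pq : p < q by rewrite /p /q; lra.
have ap : a < p by rewrite /p; lra.
have qb : q < b by rewrite /q; lra.
have qpn : q - p != 0 by rewrite subr_eq0 gt_eqF.
pose B := (g q - g p) / (q - p); exists (g p - B * p), B => t /andP[at_ tb].
have key : (q - p) * g t = (q - t) * g p + (t - p) * g q.
  have [tp|pt|->] := ltgtP t p; last by ring.
    by have := g3 _ _ _ at_ tp pq qb; lra.
  have [tq|qt|->] := ltgtP t q; last by ring.
    by have := g3 _ _ _ ap pt tq qb; lra.
  by have := g3 _ _ _ ap pq qt tb; lra.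
apply: (mulfI qpn); rewrite key /B; field.
exact: qpn.
Qed.

(** Subtracting the double primitive of [w] leaves a function annihilated by all
    second derivatives of test functions, by two integrations by parts: a
    classical one, and one against the merely integrable [w]. *)
Lemma weak_second_derivative_of_ramp a b u w : a < b -> {within `[a, b], continuous u} ->
  mu.-integrable `[a, b] (EFin \o w) ->
  (forall phi, test_function a b phi ->
    \int[mu]_(t in `[a, b]) (u t * derive1 (derive1 phi) t) =
    \int[mu]_(t in `[a, b]) (w t * phi t)) ->
  exists B : R, forall t, t \in `[a, b] ->
    u t = u a + \int[mu]_(s in `[a, t]) (B + \int[mu]_(r in `[a, s]) w r).
Proof.
move=> ab cu iw uw.
pose W s := \int[mu]_(r in `[a, s]) w r; pose U t := \int[mu]_(s in `[a, t]) W s.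
have cW : {within `[a, b], continuous W} := primitive_continuous (ltW ab) iw.
have iW := continuous_integrable cW.
have cU : {within `[a, b], continuous U} := primitive_continuous (ltW ab) iW.
pose g t := u t - U t.
have cg : {within `[a, b], continuous g} by move=> t; apply: cvgB; [exact: cu|exact: cU].
have g0 phi : test_function a b phi ->
    \int[mu]_(t in `[a, b]) (g t * derive1 (derive1 phi) t) = 0.
  move=> tphi; have tphi1 := test_function_derive tphi.
  have tphi2 := test_function_derive tphi1.
  have cphi := continuous_subspaceT (A := `[a, b]) (test_function_continuous tphi).
  have cphi1 := continuous_subspaceT (A := `[a, b]) (test_function_continuous tphi1).
  have cphi2 := continuous_subspaceT (A := `[a, b]) (test_function_continuous tphi2).
  have dphi := test_function_is_derive tphi.
  have dphi1 := test_function_is_derive tphi1.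
  have ends phi' : test_function a b phi' -> phi' a = 0 /\ phi' b = 0.
    by move=> h; split; apply: (test_function_eq0 h); [left|right].
  have [pa pb] := ends _ tphi; have [p1a p1b] := ends _ tphi1.
  have i1 := integrableM_continuous cphi1 iW.
  have i2 := integrableM_continuous cU (continuous_integrable cphi2).
  have i3 := integrableM_continuous cphi iw.
  have i4 := integrableM_continuous cu (continuous_integrable cphi2).
  have E1 : \int[mu]_(t in `[a, b]) (derive1 phi t * W t + U t * derive1 (derive1 phi) t) = 0.
    transitivity (U b * derive1 phi b - U a * derive1 phi a); last first.
      by rewrite p1a p1b !mulr0 subrr.
    apply: (@integral_derive _ _ (fun t => U t * derive1 phi t)) => //.
    - exact: ltW.
    - by move=> t; apply: cvgM; [exact: cU|exact: cphi1].
    - move=> t; apply: cvgD; first by apply: cvgM; [exact: cphi1|exact: cW].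
      by apply: cvgM; [exact: cU|exact: cphi2].
    - move=> t tab; have dU := primitive_derive cW tab.
      have d1 := dphi1 t; have := is_deriveM dU d1.
      by rewrite addrC.
  have E2 := @integration_by_parts_L1 _ _ _ _ _ _ 0 (ltW ab) cphi cphi1 (fun t _ => dphi t) iw.
  move: E2 => /=; rewrite pa pb !mul0r subrr.
  under eq_Rintegral do rewrite add0r.
  rewrite RintegralD// => E2; move: E1; rewrite RintegralD// => E1.
  rewrite (_ : \int[mu]_(t in _) _ = \int[mu]_(t in `[a, b])
    (u t * derive1 (derive1 phi) t - U t * derive1 (derive1 phi) t)); last first.
    by apply: eq_Rintegral => t _; rewrite mulrBl.
  rewrite RintegralB// uw//.
  have E3 : \int[mu]_(t in `[a, b]) (w t * phi t) = \int[mu]_(t in `[a, b]) (phi t * w t).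
    by apply: eq_Rintegral => t _; rewrite mulrC.
  by rewrite E3; lra.
(* Affine on the open interval, hence by continuity on the closed one. *)
have [A [B gAB]] := three_point_affine ab (fun p m q => three_point cg g0).
pose G t := g t - (A + B * t).
have cG : {within `[a, b], continuous G}.
  move=> t; apply: cvgB; first exact: cg.
  have : continuous (fun t => A + B * t).
    by move=> s; apply: cvgD; [exact: cvg_cst|apply: cvgM; [exact: cvg_cst|exact: cvg_id]].
  by move=> /(continuous_subspaceT (A := `[a, b])); exact.
have [_ Ga Gb] := (continuous_within_itvP _ ab).1 cG.
have G0 t : t \in `[a, b] -> G t = 0.
  rewrite in_itv/= => /andP[]; rewrite le_eqVlt => /predU1P[<- _|at_].
    apply/esym; apply: (@cvg_unique _ (@Rhausdorff R) _ _ _ _ _ Ga).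
    apply: cvg_near_cst; near=> s; rewrite /G gAB ?subrr//; apply/andP; split => //.
  rewrite le_eqVlt => /predU1P[->|tb]; last by rewrite /G gAB ?subrr// at_ tb.
  apply/esym; apply: (@cvg_unique _ (@Rhausdorff R) _ _ _ _ _ Gb).
  apply: cvg_near_cst; near=> s; rewrite /G gAB ?subrr//; apply/andP; split => //.
exists B => t tab; have := G0 _ tab; have := G0 a.
rewrite in_itv/= lexx (ltW ab) => /(_ isT).
move: (tab); rewrite in_itv/= => /andP[at_ tb].
rewrite RintegralD//; last 2 first.
- by apply: continuous_integrable => s; exact: cvg_cst.
- exact: integrable_itvS tb iW.
rewrite -/(U t) Rintegral_cst//= lebesgue_measure_itv/= lte_fin.
have -> : B * fine (if a < t then (t%:E - a%:E)%E else 0%E) = B * (t - a).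
  case: ltP => // ta; rewrite (_ : t = a) ?subrr ?mulr0//.
  by apply/le_anti; rewrite ta at_.
rewrite /G /g {1}/U set_itv1 Rintegral_set1; lra.
Unshelve. all: by end_near. Qed.

End Ramp.

(** The lemma of du Bois-Reymond of second order: a continuous function whose
    second weak derivative is integrable is a double primitive of it, up to an
    affine function. *)
Lemma weak_second_derivative_primitive a b u w : a < b -> {within `[a, b], continuous u} ->
  mu.-integrable `[a, b] (EFin \o w) ->
  (forall phi, test_function a b phi ->
    \int[mu]_(t in `[a, b]) (u t * derive1 (derive1 phi) t) =
    \int[mu]_(t in `[a, b]) (w t * phi t)) ->
  exists B : R, forall t, t \in `[a, b] ->
    u t = u a + \int[mu]_(s in `[a, t]) (B + \int[mu]_(r in `[a, s]) w r).
Proof.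
move=> ab cu iw uw; have [J [JC J0 J1]] := @smooth_ramp_exists R.
exact: (weak_second_derivative_of_ramp JC J0 J1 ab cu iw uw).
Qed.

End WeakSecondDerivative.

(** * Calculus of complex-valued functions *)
Section ComplexValued.
Context {R : realType}.
Local Notation C := R[i].
Local Notation mu := (@lebesgue_measure R).
Local Notation Re := (@complex.Re R).
Local Notation Im := (@complex.Im R).
Implicit Types (u v w F G f g : R -> C) (a b t x : R) (z : C).

Lemma ReD z1 z2 : Re (z1 + z2) = Re z1 + Re z2.
Proof. by case: z1 z2 => [? ?] []. Qed.
Lemma ImD z1 z2 : Im (z1 + z2) = Im z1 + Im z2.
Proof. by case: z1 z2 => [? ?] []. Qed.
Lemma ReN z : Re (- z) = - Re z. Proof. by case: z. Qed.
Lemma ImN z : Im (- z) = - Im z. Proof. by case: z. Qed.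
Lemma ReM z1 z2 : Re (z1 * z2) = Re z1 * Re z2 - Im z1 * Im z2.
Proof. by case: z1 z2 => [? ?] []. Qed.
Lemma ImM z1 z2 : Im (z1 * z2) = Re z1 * Im z2 + Im z1 * Re z2.
Proof. by case: z1 z2 => [? ?] []. Qed.
Lemma ReMr z (r : R) : Re (z * r%:C) = Re z * r.
Proof. by rewrite ReM /= mulr0 subr0. Qed.
Lemma ImMr z (r : R) : Im (z * r%:C) = Im z * r.
Proof. by rewrite ImM /= mulr0 add0r. Qed.
Lemma ReV z : Re z^-1 = Re z * (Re z ^+ 2 + Im z ^+ 2)^-1.
Proof. by case: z. Qed.
Lemma ImV z : Im z^-1 = - Im z * (Re z ^+ 2 + Im z ^+ 2)^-1.
Proof. by case: z => x y /=; rewrite mulNr. Qed.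

Lemma complex_ext z1 z2 : Re z1 = Re z2 -> Im z1 = Im z2 -> z1 = z2.
Proof. by case: z1 z2 => [? ?] [? ?] /= -> ->. Qed.

Lemma sqr_norm_neq0 z : z != 0 -> Re z ^+ 2 + Im z ^+ 2 != 0.
Proof.
case: z => x y; rewrite eq_complex/= negb_and => xy.
rewrite paddr_eq0 ?sqr_ge0// negb_and !expf_eq0/=.
by case/orP: xy => ->; rewrite ?orbT.
Qed.

(** The 1-norm on the plane: submultiplicative, and unlike the modulus linear
    in the absolute values of the components, hence easy to integrate. *)
Definition N1 z : R := `|Re z| + `|Im z|.

Lemma N1_ge0 z : 0 <= N1 z. Proof. exact: addr_ge0. Qed.

Lemma N1D z1 z2 : N1 (z1 + z2) <= N1 z1 + N1 z2.
Proof. by rewrite /N1 ReD ImD addrACA lerD// ler_normD. Qed.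

Lemma N1N z : N1 (- z) = N1 z. Proof. by rewrite /N1 ReN ImN !normrN. Qed.

Lemma N1M z1 z2 : N1 (z1 * z2) <= N1 z1 * N1 z2.
Proof.
rewrite /N1 ReM ImM mulrDl !mulrDr -!normrM.
apply: (@le_trans _ _ ((`|Re z1 * Re z2| + `|Im z1 * Im z2|) +
  (`|Re z1 * Im z2| + `|Im z1 * Re z2|))).
  by rewrite lerD ?ler_normB ?ler_normD.
by rewrite le_eqVlt; apply/orP; left; apply/eqP; ring.
Qed.

Lemma N1r (r : R) : N1 r%:C = `|r|.
Proof. by rewrite /N1 /= normr0 addr0. Qed.

Definition Ccontinuous (A : set R) u : Prop :=
  {within A, continuous (fun t => Re (u t))} /\ {within A, continuous (fun t => Im (u t))}.

Definition Cintegrable (A : set R) u : Prop :=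
  mu.-integrable A (EFin \o (fun t => Re (u t))) /\
  mu.-integrable A (EFin \o (fun t => Im (u t))).

Definition is_Cderive u t z : Prop :=
  is_derive t 1 (fun t => Re (u t)) (Re z) /\ is_derive t 1 (fun t => Im (u t)) (Im z).

Lemma Ccontinuous_cst (A : set R) z : Ccontinuous A (fun=> z).
Proof. by split => t; exact: cvg_cst. Qed.

Lemma CcontinuousD (A : set R) u v : Ccontinuous A u -> Ccontinuous A v ->
  Ccontinuous A (fun t => u t + v t).
Proof.
move=> [cu1 cu2] [cv1 cv2]; split.
- under [X in continuous X]eq_fun do rewrite ReD.
  by move=> t; apply: cvgD; [exact: cu1|exact: cv1].
- under [X in continuous X]eq_fun do rewrite ImD.
  by move=> t; apply: cvgD; [exact: cu2|exact: cv2].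
Qed.

Lemma CcontinuousM (A : set R) u v : Ccontinuous A u -> Ccontinuous A v ->
  Ccontinuous A (fun t => u t * v t).
Proof.
move=> [cu1 cu2] [cv1 cv2]; split.
- under [X in continuous X]eq_fun do rewrite ReM.
  by move=> t; apply: cvgB; apply: cvgM; [exact: cu1|exact: cv1|exact: cu2|exact: cv2].
- under [X in continuous X]eq_fun do rewrite ImM.
  by move=> t; apply: cvgD; apply: cvgM; [exact: cu1|exact: cv2|exact: cu2|exact: cv1].
Qed.

Lemma CcontinuousV (A : set R) u : (forall t, A t -> u t != 0) -> Ccontinuous A u ->
  Ccontinuous A (fun t => (u t)^-1).
Proof.
move=> u0 [/subspace_continuousP cu1 /subspace_continuousP cu2].
have cn t : A t -> (Re (u t) ^+ 2 + Im (u t) ^+ 2)^-1 @[t --> within A (nbhs t)] -->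
    (Re (u t) ^+ 2 + Im (u t) ^+ 2)^-1.
  move=> At; apply: cvgV; first exact/sqr_norm_neq0/u0.
  by apply: cvgD; rewrite expr2; apply: cvgM; by [exact: cu1|exact: cu2].
split; apply/subspace_continuousP => t At.
- under eq_fun do rewrite ReV.
  by apply: cvgM; [exact: cu1|exact: cn].
- under eq_fun do rewrite ImV.
  by apply: cvgM; [apply: cvgN; exact: cu2|exact: cn].
Qed.

Lemma CcontinuousW (A B : set R) u : B `<=` A -> Ccontinuous A u -> Ccontinuous B u.
Proof. by move=> BA [c1 c2]; split; exact: continuous_subspaceW BA _. Qed.

Lemma Ccontinuous_itvS a b c d u : a <= c -> d <= b ->
  Ccontinuous `[a, b] u -> Ccontinuous `[c, d] u.
Proof. by move=> ac db; apply: CcontinuousW; apply: subset_itvScc. Qed.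

Lemma Ccontinuous_int a b u : Ccontinuous `[a, b] u -> Cintegrable `[a, b] u.
Proof. by move=> [c1 c2]; split; exact: continuous_integrable. Qed.

Lemma CintegrableD (A : set R) u v : measurable A -> Cintegrable A u -> Cintegrable A v ->
  Cintegrable A (fun t => u t + v t).
Proof.
move=> mA [u1 u2] [v1 v2]; split.
- by under [X in EFin \o X]eq_fun do rewrite ReD; exact: Rintegrable_add.
- by under [X in EFin \o X]eq_fun do rewrite ImD; exact: Rintegrable_add.
Qed.

Lemma CintegrableM a b u v : Ccontinuous `[a, b] u -> Cintegrable `[a, b] v ->
  Cintegrable `[a, b] (fun t => u t * v t).
Proof.
move=> [u1 u2] [v1 v2]; split.
- under [X in EFin \o X]eq_fun do rewrite ReM.
  by apply: Rintegrable_sub => //; apply: integrableM_continuous.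
- under [X in EFin \o X]eq_fun do rewrite ImM.
  by apply: Rintegrable_add => //; apply: integrableM_continuous.
Qed.

Lemma Cintegrable_itvS a b c d u : a <= c -> d <= b ->
  Cintegrable `[a, b] u -> Cintegrable `[c, d] u.
Proof. by move=> ac db [u1 u2]; split; exact: integrable_itvS _ _ ac db _. Qed.

Lemma eq_Cintegral (A : set R) u v : (forall t, A t -> u t = v t) ->
  Cintegral A u = Cintegral A v.
Proof.
by move=> uv; rewrite /Cintegral; congr (_ +i* _); apply: eq_Rintegral => t /set_mem /uv ->.
Qed.

Lemma CintegralD (A : set R) u v : measurable A -> Cintegrable A u -> Cintegrable A v ->
  Cintegral A (fun t => u t + v t) = Cintegral A u + Cintegral A v.
Proof.
move=> mA [u1 u2] [v1 v2]; apply: complex_ext; rewrite ?ReD ?ImD /=.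
- by rewrite -RintegralD//; apply: eq_Rintegral => t _; rewrite ReD.
- by rewrite -RintegralD//; apply: eq_Rintegral => t _; rewrite ImD.
Qed.

Lemma CintegrableZ (A : set R) z u : measurable A -> Cintegrable A u ->
  Cintegrable A (fun t => z * u t).
Proof.
move=> mA [u1 u2]; split.
- under [X in EFin \o X]eq_fun do rewrite ReM.
  by apply: Rintegrable_sub => //; apply: Rintegrable_scale.
- under [X in EFin \o X]eq_fun do rewrite ImM.
  by apply: Rintegrable_add => //; apply: Rintegrable_scale.
Qed.

Lemma CintegralZ (A : set R) z u : measurable A -> Cintegrable A u ->
  Cintegral A (fun t => z * u t) = z * Cintegral A u.
Proof.
move=> mA [u1 u2].
have s r := @Rintegrable_scale _ _ A r mA u1.
have s' r := @Rintegrable_scale _ _ A r mA u2.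
apply: complex_ext; rewrite ?ReM ?ImM /= -!RintegralZl//.
- by rewrite -RintegralB//; apply: eq_Rintegral => t _; rewrite ReM.
- by rewrite -RintegralD//; apply: eq_Rintegral => t _; rewrite ImM.
Qed.

Lemma CintegrableB (A : set R) u v : measurable A -> Cintegrable A u -> Cintegrable A v ->
  Cintegrable A (fun t => u t - v t).
Proof.
move=> mA iu iv; have := CintegrableD mA iu (CintegrableZ (-1) mA iv).
by congr Cintegrable; apply/funext => t; rewrite mulN1r.
Qed.

Lemma CintegralB (A : set R) u v : measurable A -> Cintegrable A u -> Cintegrable A v ->
  Cintegral A (fun t => u t - v t) = Cintegral A u - Cintegral A v.
Proof.
move=> mA iu iv; rewrite -mulN1r -CintegralZ// -CintegralD//; last exact: CintegrableZ.
by apply: eq_Cintegral => t _; rewrite mulN1r.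
Qed.

Lemma Cintegral_point a u : Cintegral `[a, a] u = 0.
Proof. by rewrite /Cintegral set_itv1 !Rintegral_set1. Qed.

Lemma Cintegral_split a c b u : a <= c -> c <= b -> Cintegrable `[a, b] u ->
  Cintegral `[a, b] u = Cintegral `[a, c] u + Cintegral `[c, b] u.
Proof.
move=> ac cb [u1 u2].
have h (g : R -> R) : mu.-integrable `[a, b] (EFin \o g) ->
    \int[mu]_(t in `[a, b]) g t = \int[mu]_(t in `[a, c]) g t + \int[mu]_(t in `[c, b]) g t.
  move=> ig; have := @Rintegral_itvB _ g (BLeft a) (BRight b) c ig.
  rewrite !bnd_simp => /(_ ac cb) h.
  have <- : \int[mu]_(t in `]c, b]) g t = \int[mu]_(t in `[c, b]) g t.
    rewrite Rintegral_itv_obnd_cbnd//.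
    by apply: integrableS ig => //; apply: subset_itvr; rewrite bnd_simp.
  by rewrite -h addrC subrK.
by apply: complex_ext; rewrite ?ReD ?ImD /=; exact: h.
Qed.

Lemma N1_Cintegral_le a b u M : a <= b -> Cintegrable `[a, b] u ->
  (forall t, t \in `[a, b] -> N1 (u t) <= M) -> N1 (Cintegral `[a, b] u) <= M * (b - a).
Proof.
move=> ab [u1 u2] uM; rewrite /N1 /=.
have n1 := integrable_norm u1; have n2 := integrable_norm u2.
apply: (@le_trans _ _ (\int[mu]_(t in `[a, b]) `|Re (u t)| + \int[mu]_(t in `[a, b]) `|Im (u t)|)).
  by rewrite lerD// le_normr_Rintegral.
rewrite -RintegralD//; apply: le_trans (ler_norm _) _.
apply: le_normr_integral => //; first exact: Rintegrable_add.
by move=> t tab; rewrite ger0_norm ?uM// addr_ge0.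
Qed.

Lemma Cprimitive_cont a b u : a <= b -> Cintegrable `[a, b] u ->
  Ccontinuous `[a, b] (fun t => Cintegral `[a, t] u).
Proof. by move=> ab [u1 u2]; split => /=; exact: primitive_continuous. Qed.

Lemma Cprimitive_is_Cderive a b u t : Ccontinuous `[a, b] u -> t \in `]a, b[ ->
  is_Cderive (fun t => Cintegral `[a, t] u) t (u t).
Proof. by move=> [u1 u2] tab; split; exact: primitive_derive tab. Qed.

Lemma Cintegral_is_Cderive a b F f : a <= b -> Ccontinuous `[a, b] F -> Ccontinuous `[a, b] f ->
  (forall t, t \in `]a, b[ -> is_Cderive F t (f t)) -> Cintegral `[a, b] f = F b - F a.
Proof.
move=> ab [F1 F2] [f1 f2] dF; apply: complex_ext; rewrite ?(ReD, ImD) ?(ReN, ImN) /=.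
- by apply: (@integral_derive _ _ (fun t => Re (F t))) => // t /dF[].
- by apply: (@integral_derive _ _ (fun t => Im (F t))) => // t /dF[].
Qed.

Lemma is_CderiveM F (f : C) G (g : C) t : is_Cderive F t f -> is_Cderive G t g ->
  is_Cderive (fun t => F t * G t) t (f * G t + F t * g).
Proof.
move=> [F1 F2] [G1 G2]; split.
- have -> : (fun t => Re (F t * G t)) = (fun t => Re (F t)) * (fun t => Re (G t)) -
      (fun t => Im (F t)) * (fun t => Im (G t)) by apply/funext => s; rewrite ReM.
  apply: (is_derive_eq (is_deriveB (is_deriveM F1 G1) (is_deriveM F2 G2))).
  by rewrite ReD !ReM /GRing.scale/=; ring.
- have -> : (fun t => Im (F t * G t)) = (fun t => Re (F t)) * (fun t => Im (G t)) +
      (fun t => Im (F t)) * (fun t => Re (G t)) by apply/funext => s; rewrite ImM.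
  apply: (is_derive_eq (is_deriveD (is_deriveM F1 G2) (is_deriveM F2 G1))).
  by rewrite ImD !ImM /GRing.scale/=; ring.
Qed.

Lemma is_CderiveV F t (f : C) : F t != 0 -> is_Cderive F t f ->
  is_Cderive (fun t => (F t)^-1) t (- f / F t ^+ 2).
Proof.
move=> Ft0 [F1 F2]; have n0 := sqr_norm_neq0 Ft0.
pose n := (fun t => Re (F t)) * (fun t => Re (F t)) + (fun t => Im (F t)) * (fun t => Im (F t)).
have nE s : n s = Re (F s) ^+ 2 + Im (F s) ^+ 2 by rewrite !expr2.
have nt0 : n t != 0 by rewrite nE.
have dn := is_deriveD (is_deriveM F1 F1) (is_deriveM F2 F2).
have dV := @is_deriveV _ n _ _ _ nt0 dn.
have E : - f / F t ^+ 2 = - (f * (F t)^-1 * (F t)^-1) by rewrite expr2 invfM mulrA !mulNr.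
split.
- have -> : (fun t => Re (F t)^-1) = (fun t => Re (F t)) * (fun t => (n t)^-1).
    by apply/funext => s; rewrite ReV -nE.
  apply: (is_derive_eq (is_deriveM F1 dV)).
  rewrite E ReN !ReM !ImM !ReV !ImV /GRing.scale/= -nE nE; field.
  exact: n0.
- have F2N : is_derive t 1 (fun t => - Im (F t)) (- Im f) by exact: is_deriveN.
  have -> : (fun t => Im (F t)^-1) = (fun t => - Im (F t)) * (fun t => (n t)^-1).
    by apply/funext => s; rewrite ImV -nE.
  apply: (is_derive_eq (is_deriveM F2N dV)).
  rewrite E ImN !ImM !ReM !ReV !ImV /GRing.scale/= -nE nE; field.
  exact: n0.
Qed.

Lemma Cderive_val u t z : is_Cderive u t z -> Cderive u t = z.
Proof.
by move=> [d1 d2]; apply: complex_ext; rewrite /= derive1E derive_val.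
Qed.

Lemma Cintegration_by_parts F f g G a b : a <= b ->
  Ccontinuous `[a, b] F -> Ccontinuous `[a, b] f ->
  (forall t, t \in `]a, b[ -> is_Cderive F t (f t)) -> Cintegrable `[a, b] g ->
  (forall t, t \in `[a, b] -> G t = G a + Cintegral `[a, t] g) ->
  F b * G b = F a * G a + Cintegral `[a, b] (fun t => f t * G t + F t * g t).
Proof.
move=> ab cF cf dF ig GE; have [F1 F2] := cF; have [f1 f2] := cf; have [g1 g2] := ig.
have dF1 t : t \in `]a, b[ -> is_derive t 1 (fun t => Re (F t)) (Re (f t)) by move=> /dF[].
have dF2 t : t \in `]a, b[ -> is_derive t 1 (fun t => Im (F t)) (Im (f t)) by move=> /dF[].
have E11 := @integration_by_parts_L1 _ _ _ _ _ _ (Re (G a)) ab F1 f1 dF1 g1.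
have E12 := @integration_by_parts_L1 _ _ _ _ _ _ (Im (G a)) ab F1 f1 dF1 g2.
have E21 := @integration_by_parts_L1 _ _ _ _ _ _ (Re (G a)) ab F2 f2 dF2 g1.
have E22 := @integration_by_parts_L1 _ _ _ _ _ _ (Im (G a)) ab F2 f2 dF2 g2.
have bab : b \in `[a, b] by rewrite in_itv/= ab lexx.
rewrite (GE _ bab).
have -> : Cintegral `[a, b] (fun t => f t * G t + F t * g t) =
    Cintegral `[a, b] (fun t => f t * (G a + Cintegral `[a, t] g) + F t * g t).
  by apply: eq_Cintegral => t tab; rewrite -GE.
have c1 : {within `[a, b], continuous (fun t => Re (G a) + \int[mu]_(s in `[a, t]) Re (g s))}.
  by move=> t; apply: cvgD; [exact: cvg_cst|exact: (primitive_continuous ab g1)].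
have c2 : {within `[a, b], continuous (fun t => Im (G a) + \int[mu]_(s in `[a, t]) Im (g s))}.
  by move=> t; apply: cvgD; [exact: cvg_cst|exact: (primitive_continuous ab g2)].
have ii (h k l m : R -> R) : {within `[a, b], continuous h} -> {within `[a, b], continuous k} ->
    {within `[a, b], continuous l} -> mu.-integrable `[a, b] (EFin \o m) ->
    mu.-integrable `[a, b] (EFin \o (fun t => h t * k t + l t * m t)).
  move=> ch ck cl im; apply: Rintegrable_add => //; last exact: integrableM_continuous.
  by apply: integrableM_continuous => //; exact: continuous_integrable.
have i11 := ii _ _ _ _ f1 c1 F1 g1; have i12 := ii _ _ _ _ f1 c2 F1 g2.
have i21 := ii _ _ _ _ f2 c1 F2 g1; have i22 := ii _ _ _ _ f2 c2 F2 g2.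
apply: complex_ext.
- rewrite ReD !ReM /= (_ : \int[mu]_(t in _) _ =
      \int[mu]_(t in `[a, b]) (Re (f t) * (Re (G a) + \int[mu]_(s in `[a, t]) Re (g s)) +
        Re (F t) * Re (g t)) -
      \int[mu]_(t in `[a, b]) (Im (f t) * (Im (G a) + \int[mu]_(s in `[a, t]) Im (g s)) +
        Im (F t) * Im (g t))); last first.
    rewrite -RintegralB//; apply: eq_Rintegral => t _.
    by rewrite !ReD !ReM !ReD !ImD /=; ring.
  by rewrite E11 E22 !ReD !ImD /=; ring.
- rewrite ImD !ImM /= (_ : \int[mu]_(t in _) _ =
      \int[mu]_(t in `[a, b]) (Re (f t) * (Im (G a) + \int[mu]_(s in `[a, t]) Im (g s)) +
        Re (F t) * Im (g t)) +
      \int[mu]_(t in `[a, b]) (Im (f t) * (Re (G a) + \int[mu]_(s in `[a, t]) Re (g s)) +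
        Im (F t) * Re (g t))); last first.
    rewrite -RintegralD//; apply: eq_Rintegral => t _.
    by rewrite !ImD !ImM !ReD !ImD /=; ring.
  by rewrite E12 E21 !ReD !ImD /=; ring.
Qed.

Lemma Ccontinuous_bounded a b u : Ccontinuous `[a, b] u ->
  exists2 M : R, 0 <= M & forall t, t \in `[a, b] -> N1 (u t) <= M.
Proof.
move=> [/continuous_bounded[M1 M10 h1] /continuous_bounded[M2 M20 h2]].
by exists (M1 + M2); [exact: addr_ge0|move=> t tab; rewrite lerD ?h1 ?h2].
Qed.

End ComplexValued.

(** * Classical regularity and Wronskians on one interval *)
Section Regularity.
Context {R : realType}.
Local Notation C := R[i].
Local Notation mu := (@lebesgue_measure R).
Local Notation Re := (@complex.Re R).
Local Notation Im := (@complex.Im R).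
Implicit Types (u v w f : R -> C) (a b t : R) (z : C).

Lemma normr_Re_le z : `|Re z| <= Normc.normc z.
Proof. by case: z => x y /=; rewrite -sqrtr_sqr ler_wsqrtr// lerDl sqr_ge0. Qed.

Lemma normr_Im_le z : `|Im z| <= Normc.normc z.
Proof. by case: z => x y /=; rewrite -sqrtr_sqr ler_wsqrtr// lerDr sqr_ge0. Qed.

Lemma normcB z1 z2 : Normc.normc (z1 - z2) = Normc.normc (z2 - z1).
Proof. by case: z1 z2 => [x1 y1] [x2 y2] /=; rewrite -sqrrN opprB -(sqrrN (y1 - y2)) opprB. Qed.

(** The definition of absolute continuity applied to a single interval. *)
Lemma abs_cont_Ccontinuous a b u : abs_cont a b u -> Ccontinuous `[a, b] u.
Proof.
move=> uac.
have key eps : 0 < eps -> exists2 del : R, 0 < del & forall s t, s \in `[a, b] -> t \in `[a, b] ->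
    `|s - t| < del -> Normc.normc (u s - u t) < eps.
  move=> /uac[del del0 h]; exists del => //.
  have le_case s t : s \in `[a, b] -> t \in `[a, b] -> s <= t -> `|s - t| < del ->
      Normc.normc (u s - u t) < eps.
    rewrite !in_itv/= => /andP[as_ sb] /andP[at_ tb] st std.
    have := h 1%N (fun=> s) (fun=> t); rewrite !big_ord1 normcB; apply.
    - by move=> _; split.
    - by move=> i j; rewrite !ord1.
    - by rewrite -(ger0_norm (x := t - s)) ?subr_ge0// distrC.
  move=> s t sab tab; have [st|/ltW ts] := leP s t; first exact: le_case.
  by rewrite distrC normcB; exact: le_case.
split; apply/subspace_continuousP => s sab; apply/cvgrPdist_lt => eps /key[del del0 h].
all: near=> t; have tab : `[a, b]%classic t by near: t; exact: withinT.
all: have st : `|s - t| < del by near: t; apply: cvg_within; exact: nbhsx_ballx.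
- by rewrite /= -ReN -ReD; apply: le_lt_trans (normr_Re_le _) _; exact: h.
- by rewrite /= -ImN -ImD; apply: le_lt_trans (normr_Im_le _) _; exact: h.
Unshelve. all: by end_near. Qed.

(** On a set of finite measure, since 2 r <= 1 + r^2. *)
Lemma Lfun2_integrable (A : set R) (g : R -> R) : measurable A -> (mu A < +oo)%E ->
  g \_ A \in Lfun mu 2%:E -> mu.-integrable A (EFin \o g).
Proof.
move=> mA Afin gL; have mg : measurable_fun A g.
  have := sub_Lfun_mfun gL; rewrite inE => /(@measurable_funS _ _ _ _ setT A).
  move=> /(_ measurableT (@subsetT _ _)); apply: eq_measurable_fun => t tA.
  by rewrite patchE tA.
have g2 : mu.-integrable A (EFin \o (fun t => (g \_ A) t ^+ 2)).
  by apply: integrableS (Lfun2_integrable_sqr gL).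
have i1 : mu.-integrable A (EFin \o (fun=> 1)).
  apply: measurable_bounded_integrable => //.
  by exists 1; split => // N N1 t _ /=; rewrite normr1 ltW.
apply: (@le_integrable _ _ _ mu _ mA _ (EFin \o (fun t => 1 + (g \_ A) t ^+ 2))).
- exact/measurable_EFinP.
- move=> t At /=; rewrite lee_fin patchE mem_set//.
  rewrite [leRHS]ger0_norm ?addr_ge0 ?sqr_ge0// -real_normK ?num_real//.
  have : 0 <= (`|g t| - 1) ^+ 2 by exact: sqr_ge0.
  have := normr_ge0 (g t); move: `|g t| => r r0; rewrite sqrrB1; nra.
- exact: Rintegrable_add.
Qed.

Lemma integrable_itv_oo_cc a b (g : R -> R) : mu.-integrable `]a, b[ (EFin \o g) ->
  mu.-integrable `[a, b] (EFin \o g).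
Proof.
move=> /integrableP[mg fing].
have mg1 : measurable_fun `]a, b[ g by apply/measurable_EFinP.
have mg2 : measurable_fun `[a, b] g by exact: measurable_fun_itv_cc mg1.
apply/integrableP; split; first exact/measurable_EFinP.
rewrite -integral_itv_obnd_cbnd; last first.
  apply/measurable_EFinP; apply: measurableT_comp => //.
  by apply: measurable_funS mg2 => //; exact: subset_itv_oc_cc.
rewrite -integral_itv_bndo_bndc//.
by apply/measurable_EFinP; apply: measurableT_comp.
Qed.

Lemma L2_Cintegrable a b w : L2 `]a, b[ w -> Cintegrable `[a, b] w.
Proof.
have fin : (mu `]a, b[ < +oo)%E.
  by rewrite lebesgue_measure_itv/= lte_fin; case: ifP => // _; rewrite -EFinB ltry.
by move=> [w1 w2]; split; apply: integrable_itv_oo_cc; exact: Lfun2_integrable.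
Qed.

(** The classical content of H^2 membership. The end values of [u1] are the
    one-sided derivatives of [u], and [w] is its second derivative. *)
Definition regular_piece a b u u1 w : Prop :=
  [/\ Ccontinuous `[a, b] u, Ccontinuous `[a, b] u1, Cintegrable `[a, b] w,
      forall t, t \in `[a, b] -> u1 t = u1 a + Cintegral `[a, t] w &
      forall t, t \in `]a, b[ -> is_Cderive u t (u1 t)].

(** Testing against the derivative of a test function turns the two first order
    weak derivatives into a single second order one; [v] disappears and real and
    imaginary parts separate. *)
Lemma H2_regular_piece a b u v w : a < b -> Ccontinuous `[a, b] u -> H2_with a b u v w ->
  exists u1, regular_piece a b u u1 w.
Proof.
move=> ab cu [u2 v2 w2 uv vw].
have iu := Ccontinuous_int cu; have iv := L2_Cintegrable v2; have iw := L2_Cintegrable w2.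
have weak (p : C -> R) (pE : forall z (r : R), p (z * r%:C) = p z * r)
    (pN : forall z, p (- z) = - p z)
    (pI : forall (A : set R) g, p (Cintegral A g) = \int[mu]_(t in A) p (g t))
    (cpu : {within `[a, b], continuous (fun t => p (u t))})
    (ipw : mu.-integrable `[a, b] (EFin \o (fun t => p (w t)))) :
    exists B : R, forall t, t \in `[a, b] -> p (u t) =
      p (u a) + \int[mu]_(s in `[a, t]) (B + \int[mu]_(r in `[a, s]) p (w r)).
  apply: (@weak_second_derivative_primitive _ _ _ (fun t => p (u t)) (fun t => p (w t))) => //.
  move=> phi tphi; have tphi1 := test_function_derive tphi.
  have tphi2 := test_function_derive tphi1.
  have cphi := continuous_subspaceT (A := `[a, b]) (test_function_continuous tphi).
  have cphi2 := continuous_subspaceT (A := `[a, b]) (test_function_continuous tphi2).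
  rewrite -Rintegral_itv_oo_cc; last first.
    by apply: integrableM_continuous => //; exact: continuous_integrable.
  rewrite -Rintegral_itv_oo_cc; last first.
    under [X in EFin \o X]eq_fun do rewrite mulrC.
    exact: integrableM_continuous.
  have e (g : R -> C) (r : R -> R) : \int[mu]_(t in `]a, b[) (p (g t) * r t) =
      p (Cintegral `]a, b[ (fun t => g t * (r t)%:C)).
    by rewrite pI; apply: eq_Rintegral => t _; rewrite pE.
  by rewrite [LHS]e [RHS]e (uv _ tphi1) (vw _ tphi) opprK.
have [B1 E1] := weak Re ReMr ReN (fun A g => erefl) cu.1 iw.1.
have [B2 E2] := weak Im ImMr ImN (fun A g => erefl) cu.2 iw.2.
pose B := B1 +i* B2.
pose u1 t := B + Cintegral `[a, t] w; exists u1.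
have cu1 : Ccontinuous `[a, b] u1.
  by apply: CcontinuousD; [exact: Ccontinuous_cst|exact: Cprimitive_cont (ltW ab) iw].
have uE t : t \in `[a, b] -> u t = u a + Cintegral `[a, t] u1.
  move=> tab; apply: complex_ext.
  - rewrite (E1 _ tab) ReD; congr (_ + _).
  - rewrite (E2 _ tab) ImD; congr (_ + _).
split => //.
  by move=> t tab; rewrite /u1 Cintegral_point addr0.
move=> t tab; have [d1 d2] := Cprimitive_is_Cderive cu1 tab.
have near_ab : \forall s \near t, s \in `[a, b].
  near=> s; apply: subset_itv_oo_cc; near: s.
  exact: near_in_itvoo.
split.
- apply: (@near_eq_is_derive _ _ _ (fun t => Re (u a) + Re (Cintegral `[a, t] u1))).
    by near=> s; rewrite -ReD -uE//; near: s.
  by apply: (is_derive_eq (is_deriveD (is_derive_cst (Re (u a)) t 1) d1)); rewrite add0r.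
- apply: (@near_eq_is_derive _ _ _ (fun t => Im (u a) + Im (Cintegral `[a, t] u1))).
    by near=> s; rewrite -ImD -uE//; near: s.
  by apply: (is_derive_eq (is_deriveD (is_derive_cst (Im (u a)) t 1) d2)); rewrite add0r.
Unshelve. all: by end_near. Qed.

(** One-sided derivatives are limits of the derivative, and [u1] is continuous up
    to the end points. *)
Lemma regular_deriv_right a b u u1 w z : a < b -> regular_piece a b u u1 w ->
  deriv_right u a z -> z = u1 a.
Proof.
move=> ab [_ [c1 c2] _ _ du] [r1 r2].
have [_ e1 _] := (continuous_within_itvP _ ab).1 c1.
have [_ e2 _] := (continuous_within_itvP _ ab).1 c2.
have E : \forall t \near a^'+, Cderive u t = u1 t.
  near=> t; apply/Cderive_val/du; rewrite in_itv/=; apply/andP; split => //.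
apply: complex_ext.
- apply: (@cvg_unique _ (@Rhausdorff R) _ _ _ _ r1).
  apply: cvg_trans e1; apply: near_eq_cvg; near=> t.
  by congr Re; apply/esym; near: t.
- apply: (@cvg_unique _ (@Rhausdorff R) _ _ _ _ r2).
  apply: cvg_trans e2; apply: near_eq_cvg; near=> t.
  by congr Im; apply/esym; near: t.
Unshelve. all: by end_near. Qed.

Lemma regular_deriv_left a b u u1 w z : a < b -> regular_piece a b u u1 w ->
  deriv_left u b z -> z = u1 b.
Proof.
move=> ab [_ [c1 c2] _ _ du] [r1 r2].
have [_ _ e1] := (continuous_within_itvP _ ab).1 c1.
have [_ _ e2] := (continuous_within_itvP _ ab).1 c2.
have E : \forall t \near b^'-, Cderive u t = u1 t.
  near=> t; apply/Cderive_val/du; rewrite in_itv/=; apply/andP; split => //.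
apply: complex_ext.
- apply: (@cvg_unique _ (@Rhausdorff R) _ _ _ _ r1).
  apply: cvg_trans e1; apply: near_eq_cvg; near=> t.
  by congr Re; apply/esym; near: t.
- apply: (@cvg_unique _ (@Rhausdorff R) _ _ _ _ r2).
  apply: cvg_trans e2; apply: near_eq_cvg; near=> t.
  by congr Im; apply/esym; near: t.
Unshelve. all: by end_near. Qed.

Lemma Cintegral_ae a b c u v : c <= b -> Cintegrable `[a, c] u -> Cintegrable `[a, c] v ->
  {ae mu, forall t, a < t < b -> u t = v t} ->
  Cintegral `[a, c] u = Cintegral `[a, c] v.
Proof.
move=> cb [u1 u2] [v1 v2] uv.
have h (p : C -> R) : mu.-integrable `[a, c] (EFin \o (fun t => p (u t))) ->
    mu.-integrable `[a, c] (EFin \o (fun t => p (v t))) ->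
    \int[mu]_(t in `[a, c]) p (u t) = \int[mu]_(t in `[a, c]) p (v t).
  move=> iu iv; rewrite -[LHS]Rintegral_itv_oo_cc// -[RHS]Rintegral_itv_oo_cc//.
  rewrite /Rintegral; congr fine; apply: ae_eq_integral => //.
  - apply/measurable_EFinP; apply: measurable_funS (integrable_measurable iu) => //.
    exact: subset_itv_oo_cc.
  - apply/measurable_EFinP; apply: measurable_funS (integrable_measurable iv) => //.
    exact: subset_itv_oo_cc.
  - apply: (@filterS _ _ (ae_filter_ringOfSetsType mu) _ _ _ uv) => t uvt /=.
    rewrite in_itv/= => /andP[at_ tc].
    by rewrite uvt// at_ (lt_le_trans tc).
by apply: complex_ext; exact: h.
Qed.

Lemma regular_pieceS a b c u u1 w : a <= c -> c <= b -> regular_piece a b u u1 w ->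
  regular_piece a c u u1 w.
Proof.
move=> ac cb [cu cu1 iw E d]; split.
- exact: Ccontinuous_itvS cu.
- exact: Ccontinuous_itvS cu1.
- exact: Cintegrable_itvS iw.
- by move=> t; rewrite in_itv/= => /andP[at_ tc]; apply: E; rewrite in_itv/= at_ (le_trans tc).
- by move=> t; rewrite in_itv/= => /andP[at_ tc]; apply: d; rewrite in_itv/= at_ (lt_le_trans tc).
Qed.

(** Both products are absolutely continuous; in the difference of their
    derivatives the terms f' u' cancel, and the equations eliminate the second
    derivatives together with the potential. *)
Lemma wronskian_piece a b f f1 wf u u1 wu (q : R -> C) (lam : C) :
  regular_piece a b f f1 wf -> regular_piece a b u u1 wu ->
  {ae mu, forall t, a < t < b -> - wf t + q t * f t = 0 * f t} ->
  {ae mu, forall t, a < t < b -> - wu t + q t * u t = lam * u t} ->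
  forall t, t \in `[a, b] -> f t * u1 t - u t * f1 t =
    f a * u1 a - u a * f1 a - lam * Cintegral `[a, t] (fun s => f s * u s).
Proof.
move=> rf ru qf qu t; rewrite in_itv/= => /andP[at_ tb].
have [cf cf1 iwf f1E df] := regular_pieceS at_ tb rf.
have [cu cu1 iwu u1E du] := regular_pieceS at_ tb ru.
rewrite (Cintegration_by_parts at_ cf cf1 df iwu u1E).
rewrite (Cintegration_by_parts at_ cu cu1 du iwf f1E).
have i1 : Cintegrable `[a, t] (fun s => f1 s * u1 s + f s * wu s).
  by apply: CintegrableD => //; apply: CintegrableM => //; exact: Ccontinuous_int.
have i2 : Cintegrable `[a, t] (fun s => u1 s * f1 s + u s * wf s).
  by apply: CintegrableD => //; apply: CintegrableM => //; exact: Ccontinuous_int.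
have ifu : Cintegrable `[a, t] (fun s => f s * u s).
  by apply: CintegrableM => //; exact: Ccontinuous_int.
rewrite -[- (lam * _)]mulNr -CintegralZ// opprD addrACA -CintegralB//; congr (_ + _).
apply: (Cintegral_ae tb); [exact: CintegrableB|exact: CintegrableZ|].
apply: (@filterS2 _ _ (ae_filter_ringOfSetsType mu) _ _ _ _ qf qu) => s hf hu sab.
have -> : wf s = q s * f s by apply/eqP; rewrite eq_sym -subr_eq0 addrC hf// mul0r.
have -> : wu s = q s * u s - lam * u s by rewrite -hu// opprD addrCA subrr addr0 opprK.
by ring.
Qed.

End Regularity.

(** * The Volterra equation for a quotient of solutions *)
Section Volterra.
Context {R : realType}.
Local Notation C := R[i].
Implicit Types (f u q : R -> C).

Lemma nodes_le (x_ : nat -> R) N : (forall k, (k <= N)%N -> x_ k < x_ k.+1) ->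
  forall k m, (k <= m)%N -> (m <= N.+1)%N -> x_ k <= x_ m.
Proof.
move=> x_incr k; elim=> [|m IH]; first by rewrite leqn0 => /eqP ->.
rewrite leq_eqVlt => /predU1P[->//|km] mN.
by rewrite (le_trans (IH km (ltnW mN)))// ltW// x_incr.
Qed.

Section IVP.
Variables (b : R) (q : R -> C) (N : nat) (x_ : nat -> R) (alpha : nat -> C).
Variables (f u : R -> C) (h sig : C).
Hypothesis b_gt0 : 0 < b.
Hypotheses (x_0 : x_ 0%N = 0) (x_N1 : x_ N.+1 = b).
Hypothesis x_incr : forall k, (k <= N)%N -> x_ k < x_ k.+1.
Hypothesis f_sol : is_solution b q N x_ alpha 0 f.
Hypothesis u_sol : is_solution b q N x_ alpha (- sig ^+ 2) u.
Hypothesis f_neq0 : forall x, 0 <= x <= b -> f x != 0.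
Hypotheses (f_0 : f 0 = 1) (u_0 : u 0 = 1).
Hypotheses (f_deriv0 : deriv_right f 0 h) (u_deriv0 : deriv_right u 0 (sig + h)).

Let cf : Ccontinuous `[0, b] f. Proof. by case: f_sol => -[/abs_cont_Ccontinuous]. Qed.
Let cu : Ccontinuous `[0, b] u. Proof. by case: u_sol => -[/abs_cont_Ccontinuous]. Qed.
Let cfu : Ccontinuous `[0, b] (fun s => f s * u s). Proof. exact: CcontinuousM. Qed.

Let x_ge0 k : (k <= N.+1)%N -> 0 <= x_ k.
Proof. by move=> kN; rewrite -x_0; exact: (nodes_le x_incr). Qed.

Let x_leb k : (k <= N.+1)%N -> x_ k <= b.
Proof. by move=> kN; rewrite -x_N1; exact: (nodes_le x_incr). Qed.

Let piece k lam g : (k <= N)%N -> Ccontinuous `[0, b] g -> is_solution b q N x_ alpha lam g ->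
  exists g1 w, regular_piece (x_ k) (x_ k.+1) g g1 w /\
    {ae lebesgue_measure, forall t, x_ k < t < x_ k.+1 -> - w t + q t * g t = lam * g t}.
Proof.
move=> kN cg [_ /(_ _ kN)[v [w [gvw gw]]]].
have cgk : Ccontinuous `[x_ k, x_ k.+1] g.
  by apply: Ccontinuous_itvS cg; [exact/x_ge0/ltnW|exact: x_leb].
by have [g1 rg] := H2_regular_piece (x_incr kN) cgk gvw; exists g1, w.
Qed.

Let W (t : R) : C := sig + sig ^+ 2 * Cintegral `[0, t] (fun s => f s * u s).

(** The Wronskian does not jump at the nodes: there the jumps of the two
    derivatives are proportional to the values, with the same factor. *)
Let wronskian k : (k <= N)%N -> exists f1 u1 wf wu,
  [/\ regular_piece (x_ k) (x_ k.+1) f f1 wf, regular_piece (x_ k) (x_ k.+1) u u1 wu &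
      forall t, t \in `[x_ k, x_ k.+1] -> f t * u1 t - u t * f1 t = W t].
Proof.
have step j : (j <= N)%N -> forall f1 u1 wf wu,
    regular_piece (x_ j) (x_ j.+1) f f1 wf -> regular_piece (x_ j) (x_ j.+1) u u1 wu ->
    {ae lebesgue_measure, forall t, x_ j < t < x_ j.+1 -> - wf t + q t * f t = 0 * f t} ->
    {ae lebesgue_measure, forall t, x_ j < t < x_ j.+1 ->
      - wu t + q t * u t = - sig ^+ 2 * u t} ->
    f (x_ j) * u1 (x_ j) - u (x_ j) * f1 (x_ j) = W (x_ j) ->
    forall t, t \in `[x_ j, x_ j.+1] -> f t * u1 t - u t * f1 t = W t.
  move=> jN f1 u1 wf wu rf ru ef eu Wj t tj.
  rewrite (wronskian_piece rf ru ef eu tj) Wj /W mulNr opprK -addrA -mulrDr.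
  move: tj; rewrite in_itv/= => /andP[jt tj1]; rewrite -Cintegral_split//.
    exact/x_ge0/ltnW.
  apply: Ccontinuous_int; apply: Ccontinuous_itvS cfu => //.
  exact: le_trans tj1 (x_leb _).
have in_r j : (j <= N)%N -> x_ j.+1 \in `[x_ j, x_ j.+1].
  by move=> jN; rewrite in_itv/= lexx ltW// x_incr.
elim: k => [N0|k IH kN].
- have [f1 [wf [rf ef]]] := piece N0 cf f_sol.
  have [u1 [wu [ru eu]]] := piece N0 cu u_sol.
  exists f1, u1, wf, wu; split => //; apply: step ef eu _ => //.
  have f1h : h = f1 (x_ 0%N).
    by apply: regular_deriv_right rf _; [exact: x_incr|rewrite x_0].
  have u1h : sig + h = u1 (x_ 0%N).
    by apply: regular_deriv_right ru _; [exact: x_incr|rewrite x_0].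
  by rewrite -f1h -u1h x_0 f_0 u_0 /W Cintegral_point mulr0 addr0 !mul1r addrK.
- have [f1 [u1 [wf [wu [rf ru Wk]]]]] := IH (ltnW kN).
  have [f1' [wf' [rf' ef]]] := piece kN cf f_sol.
  have [u1' [wu' [ru' eu]]] := piece kN cu u_sol.
  exists f1', u1', wf', wu'; split => //; apply: step ef eu _ => //.
  rewrite -Wk; last exact/in_r/ltnW.
  have xk := x_incr (ltnW kN); have xk1 := x_incr kN.
  have [[_ _ /(_ k.+1 kN)[fl [fr [dfl dfr fj]]]] _] := f_sol.
  have [[_ _ /(_ k.+1 kN)[ul [ur [dul dur uj]]]] _] := u_sol.
  rewrite -(regular_deriv_left xk rf dfl) -(regular_deriv_left xk ru dul).
  rewrite -(regular_deriv_right xk1 rf' dfr) -(regular_deriv_right xk1 ru' dur).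
  have -> : fr = fl + alpha k.+1 * f (x_ k.+1) by rewrite -fj addrC subrK.
  have -> : ur = ul + alpha k.+1 * u (x_ k.+1) by rewrite -uj addrC subrK.
  by ring.
Qed.

Let g (s : R) : C := W s / f s ^+ 2.

Let cg : Ccontinuous `[0, b] g.
Proof.
apply: CcontinuousM.
- apply: CcontinuousD; first exact: Ccontinuous_cst.
  apply: CcontinuousM; first exact: Ccontinuous_cst.
  exact: Cprimitive_cont (ltW b_gt0) (Ccontinuous_int cfu).
- apply: (@CcontinuousV _ _ (fun t => f t ^+ 2)); last exact: (CcontinuousM cf cf).
  by move=> t; rewrite /= in_itv/= => tb; rewrite expf_neq0// f_neq0.
Qed.

(** The derivative of u/f is the Wronskian over f^2. Since the integrand is
    continuous on the whole interval, the fundamental theorem on the successive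
    intervals between nodes adds up to a single integral. *)
Lemma quotient_volterra x : 0 <= x <= b -> u x / f x =
  1 + Cintegral `[0, x] (fun s =>
    (sig + sig ^+ 2 * Cintegral `[0, s] (fun r => f r * u r)) / f s ^+ 2).
Proof.
have cv : Ccontinuous `[0, b] (fun t => u t * (f t)^-1).
  by apply: CcontinuousM => //; apply: CcontinuousV => // t; rewrite /= in_itv/=; exact: f_neq0.
rewrite -/g.
suff H k : (k <= N.+1)%N -> forall t, 0 <= t <= x_ k -> u t / f t = 1 + Cintegral `[0, t] g.
  by move=> xb; apply: (H N.+1) => //; rewrite x_N1.
elim: k => [_ t|k IH kN t /andP[t0 tk1]].
  rewrite x_0 => /andP[t0 t0']; have -> : t = 0 by apply/le_anti; rewrite t0 t0'.
  by rewrite f_0 u_0 divr1 Cintegral_point addr0.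
have [tk|kt] := leP t (x_ k); first by apply: IH; [exact: ltnW|rewrite t0].
have [f1 [u1 [wf [wu [rf ru Wk]]]]] := wronskian kN.
have [_ _ _ _ df] := rf; have [_ _ _ _ du] := ru.
have k0 : 0 <= x_ k by exact/x_ge0/ltnW.
have tb : t <= b := le_trans tk1 (x_leb kN).
rewrite (Cintegral_split k0 (ltW kt)); last by apply: Ccontinuous_int; exact: Ccontinuous_itvS cg.
rewrite addrA -IH; [|exact: ltnW|by rewrite k0 lexx].
rewrite (@Cintegral_is_Cderive _ _ _ (fun t => u t * (f t)^-1) g (ltW kt)).
- by rewrite addrC subrK.
- exact: Ccontinuous_itvS cv.
- exact: Ccontinuous_itvS cg.
- move=> s; rewrite in_itv/= => /andP[ks st].
  have sk : s \in `]x_ k, x_ k.+1[ by rewrite in_itv/= ks (lt_le_trans st).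
  have fs0 : f s != 0.
    by apply: f_neq0; rewrite (le_trans k0 (ltW ks)) (le_trans (ltW st) tb).
  have -> : g s = u1 s * (f s)^-1 + u s * (- f1 s / f s ^+ 2).
    rewrite /g -Wk; last exact: subset_itv_oo_cc sk.
    by field.
  by apply: is_CderiveM; [exact: du|apply: is_CderiveV => //; exact: df].
Qed.

End IVP.
End Volterra.

(** * Taylor remainders of the exponential and vanishing polynomials *)
Section Taylor.
Context {R : realType}.
Local Notation C := R[i].
Implicit Types (n : nat) (s : R).

Definition exp_poly n : {poly R} := \poly_(k < n) (k`!%:R)^-1.

Lemma deriv_exp_poly n : (exp_poly n.+1)^`() = exp_poly n.
Proof.
apply/polyP => i; rewrite coef_deriv !coef_poly ltnS; case: ifP => _; last by rewrite mul0rn.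
rewrite -mulr_natl factS natrM; field.
by rewrite nat1r !pnatr_eq0 -lt0n fact_gt0.
Qed.

Lemma horner_exp_poly n s : (exp_poly n).[s] = \sum_(k < n) (k`!%:R)^-1 * s ^+ k.
Proof. by rewrite horner_poly. Qed.

(** Differentiating a remainder gives the remainder of the next lower order, so the
    mean value theorem yields the bound by induction. *)
Lemma expR_taylor n s : `|expR s - (exp_poly n).[s]| <= `|s| ^+ n * expR `|s|.
Proof.
elim: n s => [|n IH] s.
  rewrite expr0 mul1r horner_exp_poly big_ord0 subr0 ger0_norm ?expR_ge0//.
  by rewrite ler_expR ler_norm.
pose D m (t : R) := expR t - (exp_poly m).[t].
have dD (t : R) : is_derive t 1 (D n.+1) (D n t).
  have d1 : is_derive t 1 (@expR R) (expR t) by exact: is_derive_expR.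
  have d2 : is_derive t 1 (horner (exp_poly n.+1)) ((exp_poly n).[t]).
    split; first exact: derivable_horner.
    by rewrite -derive1E -derivE deriv_exp_poly.
  exact: is_deriveB.
have D0 : D n.+1 0 = 0.
  rewrite /D expR0 horner_exp_poly big_ord_recl big1 ?addr0.
    by rewrite fact0 invr1 expr0 mulr1 subrr.
  by move=> i _; rewrite expr0n/= mulr0.
have cD (A : set R) : {within A, continuous (D n.+1)}.
  by apply: continuous_subspaceT; apply: derivable1_continuous => x; have [] := dD x.
suff [c cs cE] : exists2 c, `|c| <= `|s| & `|D n.+1 s| = `|D n c| * `|s|.
  rewrite -/(D n.+1 s) cE exprSr mulrAC ler_wpM2r// (le_trans (IH c))//.
  by rewrite ler_pM ?exprn_ge0 ?expR_ge0 ?ler_expR// lerXn2r// nnegrE.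
have [s0|/ltW s0] := leP 0 s.
- have [c] := MVT_segment s0 (fun t _ => dD t) (cD _).
  rewrite in_itv/= => /andP[c0 cs]; rewrite D0 !subr0 => E.
  by exists c; rewrite ?E ?normrM// !ger0_norm.
- have [c] := MVT_segment s0 (fun t _ => dD t) (cD _).
  rewrite in_itv/= => /andP[sc c0]; rewrite D0 !sub0r => E.
  exists c; last by rewrite -normrN E normrM normrN.
  by rewrite !ler0_norm// lerN2.
Qed.

(** Letting [s] tend to 0 kills the constant coefficient; then divide by [s] and
    repeat. *)
Lemma poly_small_eq0 n (c : nat -> R) (del M : R) : 0 < del ->
  (forall s, 0 < s <= del -> `|\sum_(k < n) c k * s ^+ k| <= M * s ^+ n) ->
  forall k, (k < n)%N -> c k = 0.
Proof.
move=> del0; elim: n c => // n IH c h.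
pose S := \sum_(k < n) `|c k.+1| * del ^+ k.
have S0 : 0 <= S by apply: sumr_ge0 => i _; rewrite mulr_ge0// exprn_ge0// ltW.
have tail s : 0 < s <= del -> `|\sum_(k < n) c k.+1 * s ^+ k| <= S.
  move=> /andP[s0 sd]; apply: le_trans (ler_norm_sum _ _ _) _; apply: ler_sum => i _.
  rewrite normrM ler_wpM2l// normrX lerXn2r ?nnegrE// ?(ltW del0)//.
  by rewrite gtr0_norm.
have split s : \sum_(k < n.+1) c k * s ^+ k = c 0%N + s * \sum_(k < n) c k.+1 * s ^+ k.
  rewrite big_ord_recl expr0 mulr1 mulr_sumr; congr (_ + _).
  by apply: eq_bigr => i _; rewrite mulrCA -exprS.
have c0 : c 0%N = 0.
  apply/eqP; rewrite -normr_eq0 eq_le normr_ge0 andbT.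
  apply/ler_addgt0Pl => e e0; rewrite addr0.
  (* With [s] at most del, the constant coefficient is at most [s * A]. *)
  pose A := `|M| * del ^+ n + S + 1.
  have A0 : 0 < A by rewrite ltr_wpDl// addr_ge0// mulr_ge0// exprn_ge0// ltW.
  pose s := Num.min del (e / A).
  have s0 : 0 < s by rewrite lt_min del0 divr_gt0.
  have sd : s <= del by rewrite ge_min lexx.
  have sA : s * A <= e by rewrite -ler_pdivlMr// ge_min lexx orbT.
  have sdel : 0 < s <= del by rewrite s0.
  have := h _ sdel; rewrite split => h1.
  have h2 := tail _ sdel; clearbody s.
  set T := \sum_(k < n) _ in h1 h2.
  have -> : c 0%N = (c 0%N + s * T) - s * T by rewrite addrK.
  apply: le_trans (ler_normB _ _) _; apply: le_trans sA.
  have -> : s * A = s * (`|M| * del ^+ n) + s * S + s by rewrite /A; ring.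
  rewrite -[leLHS]addr0 lerD ?(ltW s0)// lerD//.
    apply: le_trans h1 _; rewrite exprS mulrCA ler_wpM2l ?(ltW s0)//.
    apply: (@le_trans _ _ (`|M| * s ^+ n)).
      by rewrite ler_wpM2r ?exprn_ge0 ?(ltW s0)// ler_norm.
    by rewrite ler_wpM2l// lerXn2r ?nnegrE// ltW.
  by rewrite normrM gtr0_norm// ler_wpM2l ?(ltW s0).
case=> [|k] kn; first exact: c0.
apply: (IH (fun k => c k.+1)) => // s sdel; have := h _ sdel.
have /andP[s0 _] := sdel.
by rewrite split c0 add0r normrM gtr0_norm// exprS mulrCA ler_pM2l.
Qed.

Lemma Cpoly_small_eq0 n (c : nat -> C) (del M : R) : 0 < del ->
  (forall s, 0 < s <= del -> N1 (\sum_(k < n) c k * (s ^+ k)%:C) <= M * s ^+ n) ->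
  forall k, (k < n)%N -> c k = 0.
Proof.
move=> del0 h k kn.
have sumE (p : C -> R) (pD : forall z1 z2, p (z1 + z2) = p z1 + p z2)
   (pM : forall z (r : R), p (z * r%:C) = p z * r) (p0 : p 0 = 0)
   (pN : forall z, `|p z| <= N1 z) : p (c k) = 0.
  apply: (@poly_small_eq0 n (fun k => p (c k)) del M) => // s /h.
  apply: le_trans; apply: le_trans (pN _).
  rewrite (big_morph p pD p0) le_eqVlt; apply/orP; left; apply/eqP; congr `|_|.
  by apply: eq_bigr => i _; rewrite pM.
apply: complex_ext => /=; apply: sumE => //.
- exact: ReD.
- exact: ReMr.
- by move=> z; rewrite lerDl.
- exact: ImD.
- exact: ImMr.
- by move=> z; rewrite lerDr.
Qed.

End Taylor.

(** * Formal powers as Taylor coefficients *)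
Section FormalPowerSeries.
Context {R : realType}.
Local Notation C := R[i].
Variables (b : R) (f : R -> C).
Hypothesis b_ge0 : 0 <= b.
Hypothesis cf : Ccontinuous `[0, b] f.
Hypothesis f_neq0 : forall x, 0 <= x <= b -> f x != 0.

(** The formal power phi^(k) divided by [f]. *)
Definition ratio_power k (x : R) : C := if odd k then X f k x else Xtilde f k x.

Let p (s : R) : C := f s ^+ 2.
Let r (s : R) : C := (f s ^+ 2)^-1.

Let cp : Ccontinuous `[0, b] p. Proof. exact: CcontinuousM. Qed.

Let cr : Ccontinuous `[0, b] r.
Proof.
apply: (@CcontinuousV _ _ (fun t => f t ^+ 2)); last exact: (CcontinuousM cf cf).
by move=> t; rewrite /= in_itv/= => tb; rewrite expf_neq0// f_neq0.
Qed.

(** The double integral operator of the Volterra equation. It raises the order of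
    the formal powers by two ([ratio_power2]), and thus sends a Taylor coefficient
    [d k] to [d k.+2] ([d2]). *)
Let T (w : R -> C) (x : R) : C :=
  Cintegral `[0, x] (fun s => r s * Cintegral `[0, s] (fun t => p t * w t)).

Let cprim w : Ccontinuous `[0, b] w -> Ccontinuous `[0, b] (fun x => Cintegral `[0, x] w).
Proof. by move=> cw; exact: Cprimitive_cont b_ge0 (Ccontinuous_int cw). Qed.

Let in0 x : x \in `[0, b] -> forall s, `[0, x]%classic s -> s \in `[0, b].
Proof.
rewrite in_itv/= => /andP[_ xb] s; rewrite /= !in_itv/= => /andP[s0 sx].
by rewrite s0 (le_trans sx).
Qed.

Let T_lin w1 w2 c x : x \in `[0, b] -> Ccontinuous `[0, b] w1 -> Ccontinuous `[0, b] w2 ->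
  T (fun t => w1 t + c * w2 t) x = T w1 x + c * T w2 x.
Proof.
move=> xb c1 c2.
have int0 w y : y \in `[0, b] -> Ccontinuous `[0, b] w -> Cintegrable `[0, y] w.
  by rewrite in_itv/= => /andP[_ yb] cw; apply: Ccontinuous_int; exact: Ccontinuous_itvS cw.
have cpw w : Ccontinuous `[0, b] w -> Ccontinuous `[0, b] (fun t => p t * w t).
  exact: CcontinuousM.
have crw w : Ccontinuous `[0, b] w ->
    Ccontinuous `[0, b] (fun s => r s * Cintegral `[0, s] (fun t => p t * w t)).
  by move=> cw; apply: CcontinuousM => //; apply: cprim; exact: cpw.
rewrite /T -CintegralZ//; last exact/int0/crw.
rewrite -CintegralD//; [|exact/int0/crw|by apply: CintegrableZ => //; exact/int0/crw].
apply: eq_Cintegral => s /(in0 xb) sb.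
rewrite mulrCA -mulrDr; congr (_ * _).
rewrite -CintegralZ//; last exact/int0/cpw.
rewrite -CintegralD//; [|exact/int0/cpw|by apply: CintegrableZ => //; exact/int0/cpw].
by apply: eq_Cintegral => t _; ring.
Qed.

Let T_bound : exists2 L : R, 0 <= L & forall w M, Ccontinuous `[0, b] w ->
  (forall x, x \in `[0, b] -> N1 (w x) <= M) ->
  forall x, x \in `[0, b] -> N1 (T w x) <= L * M.
Proof.
have [B1 B10 pB] := Ccontinuous_bounded cp; have [B2 B20 rB] := Ccontinuous_bounded cr.
exists (B2 * (B1 * b) * b); first by rewrite !mulr_ge0.
move=> w M cw wM x xb; have xb' := xb; move: xb; rewrite in_itv/= => /andP[x0 xb].
have M0 : 0 <= M by apply: le_trans (wM _ xb'); exact: N1_ge0.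
have cpw : Ccontinuous `[0, b] (fun t => p t * w t) by exact: CcontinuousM.
have bnd (g : R -> C) (Q y : R) : 0 <= Q -> y \in `[0, b] -> Ccontinuous `[0, b] g ->
    (forall t, t \in `[0, b] -> N1 (g t) <= Q) -> N1 (Cintegral `[0, y] g) <= Q * b.
  move=> Q0 yb' cg gQ; have yb := yb'; move: yb; rewrite in_itv/= => /andP[y0 yb].
  apply: (@le_trans _ _ (Q * (y - 0))).
    apply: N1_Cintegral_le => //; first by apply: Ccontinuous_int; exact: Ccontinuous_itvS cg.
    by move=> t ty; apply: gQ; exact: in0 yb' _ ty.
  by rewrite subr0 ler_wpM2l.
have -> : B2 * (B1 * b) * b * M = B2 * (B1 * M * b) * b by ring.
apply: (bnd) => //.
- by rewrite !mulr_ge0.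
- by apply: CcontinuousM => //; exact: cprim.
- move=> s sb; apply: le_trans (N1M _ _) _; rewrite ler_pM ?N1_ge0// ?rB//.
  apply: (bnd) => //; first by rewrite mulr_ge0.
  move=> t tb; apply: le_trans (N1M _ _) _.
  by rewrite ler_pM ?N1_ge0// ?pB// wM.
Qed.

Let d k x : C := ratio_power k x / (k`!)%:R.

(** In both parities the inner weight is [p] and the outer one [r]: the alternating
    exponents are arranged so that the two families follow one recursion of step
    two. *)
Let ratio_power2 k x : ratio_power k.+2 x = (k.+2)%:R *
  Cintegral `[0, x] (fun s => (k.+1)%:R * Cintegral `[0, s] (fun t => p t * ratio_power k t) * r s).
Proof.
rewrite /ratio_power /= negbK; case: ifP => ok; congr (_ * _); apply: eq_Cintegral => s _.
- congr (_ * _ * _).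
    apply: eq_Cintegral => t _; rewrite mulrC; congr (_ * _).
    by rewrite -signr_odd /= ok/= expr0 expr1z.
  by rewrite -signr_odd /= negbK ok expr1 exprN1.
- congr (_ * _ * _).
    apply: eq_Cintegral => t _; rewrite mulrC; congr (_ * _).
    by rewrite -signr_odd ok expr0 expr1z.
  by rewrite -signr_odd /= ok expr1 exprN1.
Qed.

Let ratio_power_cont k : Ccontinuous `[0, b] (ratio_power k).
Proof.
suff : Ccontinuous `[0, b] (ratio_power k) /\ Ccontinuous `[0, b] (ratio_power k.+1) by case.
elim: k => [|k [IH1 IH2]].
  split; first exact: Ccontinuous_cst.
  apply: CcontinuousM; first exact: Ccontinuous_cst.
  apply: cprim; apply: CcontinuousM; first exact: Ccontinuous_cst.
  rewrite (_ : (fun t => _) = r); first exact: cr.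
  by apply/funext => t; rewrite expr1 exprN1.
split => //; rewrite (funext (ratio_power2 k)).
apply: CcontinuousM; first exact: Ccontinuous_cst.
apply: cprim; apply: CcontinuousM => //; apply: CcontinuousM; first exact: Ccontinuous_cst.
by apply: cprim; exact: (CcontinuousM cp IH1).
Qed.

Let d_cont k : Ccontinuous `[0, b] (d k).
Proof. by apply: CcontinuousM; [exact: ratio_power_cont|exact: Ccontinuous_cst]. Qed.

Let d0 x : d 0 x = 1. Proof. by rewrite /d /ratio_power/= fact0 divr1. Qed.

Let d2 k x : x \in `[0, b] -> d k.+2 x = T (d k) x.
Proof.
move=> xb.
have int0 w y : y \in `[0, b] -> Ccontinuous `[0, b] w -> Cintegrable `[0, y] w.
  by rewrite in_itv/= => /andP[_ yb] cw; apply: Ccontinuous_int; exact: Ccontinuous_itvS cw.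
have kn n : (n.+1)%:R != 0 :> C by rewrite pnatr_eq0.
have fn : (k`!)%:R != 0 :> C by rewrite pnatr_eq0 -lt0n fact_gt0.
pose I s := Cintegral `[0, s] (fun t => p t * ratio_power k t).
have cI : Ccontinuous `[0, b] I by apply: cprim; exact: (CcontinuousM cp (ratio_power_cont k)).
have E s : s \in `[0, b] -> Cintegral `[0, s] (fun t => p t * d k t) = (k`!)%:R^-1 * I s.
  move=> sb; rewrite /I -CintegralZ//.
    by apply: eq_Cintegral => t _; rewrite /d; ring.
  exact: (int0 _ _ sb (CcontinuousM cp (ratio_power_cont k))).
rewrite /T (@eq_Cintegral _ _ _ (fun s => (k`!)%:R^-1 * (r s * I s))); last first.
  by move=> s /(in0 xb) sb; rewrite E// mulrCA.
rewrite CintegralZ//; last by apply: int0 => //; exact: CcontinuousM.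
rewrite {1}/d ratio_power2.
rewrite (@eq_Cintegral _ _ (fun s => k.+1%:R * I s * r s)
  (fun s => k.+1%:R * (r s * I s))); last first.
  by move=> s _; rewrite -mulrA [I s * _]mulrC.
rewrite CintegralZ//; last by apply: int0 => //; exact: CcontinuousM.
rewrite !factS !natrM; field.
by rewrite fn nat1r -natrD !pnatr_eq0.
Qed.

(** Solutions of the Volterra equation are expanded in powers of the spectral
    parameter, which enters it quadratically: each application of the double
    integral operator accounts for two orders. *)
Lemma volterra_expansion : exists2 del : R, 0 < del & forall m, exists M : R,
  forall (s : R) (v : R -> C), 0 < s <= del -> Ccontinuous `[0, b] v ->
  (forall x, x \in `[0, b] -> v x = 1 + Cintegral `[0, x] (fun y =>
    (s%:C + s%:C ^+ 2 * Cintegral `[0, y] (fun t => f t ^+ 2 * v t)) / f y ^+ 2)) ->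
  forall x, x \in `[0, b] ->
    N1 (v x - \sum_(k < m.*2) ratio_power k x / (k`!)%:R * (s ^+ k)%:C) <= M * s ^+ m.*2.
Proof.
have [L L0 TL] := T_bound.
have [D D0 dD] := Ccontinuous_bounded (d_cont 1).
(* Small enough for [s ^+ 2 * L <= 1/2], which makes the equation a contraction
   and bounds its solutions independently of [s]. *)
pose del := Num.min 1 (2 * (L + 1))^-1.
have L1 : 0 < 2 * (L + 1) by rewrite mulr_gt0// ltr_wpDl.
exists del; first by rewrite lt_min ltr01 invr_gt0.
move=> m; exists (L ^+ m * (2 * (1 + D))) => s v /andP[s0 sdel] cv vE.
have s1 : s <= 1 by rewrite (le_trans sdel)// ge_min lexx.
have sL : s ^+ 2 * L <= 2^-1.
  have : s <= (2 * (L + 1))^-1 by rewrite (le_trans sdel)// ge_min lexx orbT.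
  rewrite -[_^-1]mul1r ler_pdivlMr// => h.
  have : s ^+ 2 * L <= s * (L + 1).
    rewrite expr2 -mulrA ler_wpM2l ?(ltW s0)//.
    by apply: (@le_trans _ _ (1 * L)); [rewrite ler_wpM2r|lra].
  by lra.
have int0 w y : y \in `[0, b] -> Ccontinuous `[0, b] w -> Cintegrable `[0, y] w.
  by rewrite in_itv/= => /andP[_ yb] cw; apply: Ccontinuous_int; exact: Ccontinuous_itvS cw.
have {}vE x : x \in `[0, b] -> v x = 1 + s%:C * d 1 x + s%:C ^+ 2 * T v x.
  move=> xb; rewrite vE// -addrA; congr (_ + _).
  have cpv : Ccontinuous `[0, b] (fun y => r y * Cintegral `[0, y] (fun t => p t * v t)).
    by apply: CcontinuousM => //; apply: cprim; exact: CcontinuousM.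
  rewrite (_ : d 1 x = Cintegral `[0, x] r); last first.
    rewrite /d /ratio_power /= divr1 mul1r; apply: eq_Cintegral => t _.
    by rewrite mul1r expr1 exprN1.
  rewrite /T -!CintegralZ//; [|exact: int0|exact: int0].
  rewrite -CintegralD//; [|by apply: CintegrableZ => //; exact: int0..].
  apply: eq_Cintegral => t _; rewrite mulrDl; congr (_ + _).
  by rewrite -mulrA; congr (_ * _); exact: mulrC.
have vM x : x \in `[0, b] -> N1 (v x) <= 2 * (1 + D).
  have [v1 v2] := cv.
  have cN : {within `[0, b], continuous (fun x => N1 (v x))}.
    by move=> t; apply: cvgD; apply: cvg_norm; [exact: v1|exact: v2].
  have [c cb cmax] := EVT_max b_ge0 cN.
  move=> xb; apply: le_trans (cmax _ xb) _.
  have : N1 (v c) <= 1 + D + N1 (v c) / 2.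
    rewrite {1}vE//; apply: le_trans (N1D _ _) _; apply: lerD.
      apply: le_trans (N1D _ _) _; apply: lerD.
        by rewrite (N1r 1) normr1.
      apply: le_trans (N1M _ _) _; rewrite N1r gtr0_norm//.
      by rewrite -[leRHS]mul1r ler_pM ?N1_ge0 ?(ltW s0)// dD.
    apply: le_trans (N1M _ _) _; rewrite -rmorphXn N1r ger0_norm ?exprn_ge0 ?(ltW s0)//.
    apply: (@le_trans _ _ (s ^+ 2 * (L * N1 (v c)))).
      by rewrite ler_wpM2l ?exprn_ge0 ?(ltW s0)// TL.
    by rewrite mulrA [leRHS]mulrC ler_wpM2r ?N1_ge0.
  lra.
(* The remainder after [n] terms. Two more terms amount to one application of
   [s ^+ 2 * T] to the remainder ([ET]), so the bound gains [s ^+ 2] each time. *)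
pose E := fix E n x := if n is n'.+1 then E n' x + (- (s ^+ n')%:C) * d n' x else v x.
have cE n : Ccontinuous `[0, b] (E n).
  elim: n => [|n IH]; first exact: cv.
  by apply: CcontinuousD => //; apply: CcontinuousM; [exact: Ccontinuous_cst|exact: d_cont].
have Esum n x : E n x = v x - \sum_(k < n) ratio_power k x / (k`!)%:R * (s ^+ k)%:C.
  elim: n => [|n IH]; first by rewrite big_ord0 subr0.
  by rewrite big_ord_recr opprD addrA -IH /= mulNr [_ * (s ^+ n)%:C]mulrC.
have ET n x : x \in `[0, b] -> E n.+2 x = s%:C ^+ 2 * T (E n) x.
  elim: n x => [|n IH] x xb.
    by rewrite /= vE// d0 expr0 expr1; ring.
  transitivity (E n.+2 x + - (s ^+ n.+2)%:C * d n.+2 x); first by [].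
  rewrite IH// d2//.
  rewrite (_ : T (E n.+1) x = T (E n) x + - (s ^+ n)%:C * T (d n) x); last exact: T_lin.
  have -> : (s ^+ n.+2)%:C = s%:C ^+ 2 * (s ^+ n)%:C :> C.
    by rewrite -rmorphXn -rmorphM -exprD.
  by rewrite [RHS]mulrDr [s%:C ^+ 2 * (_ * _)]mulrA mulrN.
move=> x xb; rewrite -Esum.
elim: m x xb => [|m IH] x xb.
  by rewrite expr0 mul1r mulr1 vM.
rewrite doubleS ET//; apply: le_trans (N1M _ _) _.
rewrite -rmorphXn N1r ger0_norm ?exprn_ge0 ?(ltW s0)//.
have -> : L ^+ m.+1 * (2 * (1 + D)) * s ^+ m.*2.+2 =
  s ^+ 2 * (L * (L ^+ m * (2 * (1 + D)) * s ^+ m.*2)).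
  by rewrite [L ^+ m.+1]exprS -[m.*2.+2]/(2 + m.*2)%N exprD; ring.
by rewrite ler_wpM2l ?exprn_ge0 ?(ltW s0)// TL.
Qed.

End FormalPowerSeries.

(** * Moments of the kernel *)
Section Moments.
Context {R : realType}.
Local Notation C := R[i].
Local Notation mu := (@lebesgue_measure R).
Local Notation Re := (@complex.Re R).
Local Notation Im := (@complex.Im R).
Implicit Types (K : R -> C) (g : R -> R) (a b : R).

Lemma Cintegrable_mulr a b K g : {within `[a, b], continuous g} -> Cintegrable `[a, b] K ->
  Cintegrable `[a, b] (fun t => K t * (g t)%:C).
Proof.
move=> cg [K1 K2]; split.
- under [X in EFin \o X]eq_fun do rewrite ReMr mulrC.
  exact: integrableM_continuous.
- under [X in EFin \o X]eq_fun do rewrite ImMr mulrC.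
  exact: integrableM_continuous.
Qed.

Lemma Cintegral_mulr_bounded a b K : Cintegrable `[a, b] K -> exists2 Q : R, 0 <= Q &
  forall g M, {within `[a, b], continuous g} -> (forall t, t \in `[a, b] -> `|g t| <= M) ->
  N1 (Cintegral `[a, b] (fun t => K t * (g t)%:C)) <= Q * M.
Proof.
move=> [K1 K2].
exists (\int[mu]_(t in `[a, b]) `|Re (K t)| + \int[mu]_(t in `[a, b]) `|Im (K t)|).
  by apply: addr_ge0; exact: Rintegral_ge0.
move=> g M cg gM; rewrite /N1 /= mulrDl.
have h (p : R -> R) : mu.-integrable `[a, b] (EFin \o p) ->
    `|\int[mu]_(t in `[a, b]) (p t * g t)| <= (\int[mu]_(t in `[a, b]) `|p t|) * M.
  move=> ip; have ipn := integrable_norm ip.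
  have ipg : mu.-integrable `[a, b] (EFin \o (fun t => p t * g t)).
    under [X in EFin \o X]eq_fun do rewrite mulrC.
    exact: integrableM_continuous.
  apply: le_trans (le_normr_Rintegral _ ipg) _ => //.
  rewrite mulrC -RintegralZl//; apply: le_Rintegral => //.
  + by have := integrable_norm ipg.
  + exact: Rintegrable_scale.
  + by move=> t tab; rewrite normrM mulrC ler_wpM2r// gM.
rewrite lerD//.
- by under eq_Rintegral do rewrite ReMr; exact: h.
- by under eq_Rintegral do rewrite ImMr; exact: h.
Qed.

Lemma Cintegrable_sum (A : set R) n (z : nat -> C) (F : nat -> R -> C) : measurable A ->
  (forall j, Cintegrable A (F j)) -> Cintegrable A (fun t => \sum_(j < n) z j * F j t).
Proof.
move=> mA iF; elim: n => [|n IH].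
  under eq_fun do rewrite big_ord0.
  have := CintegrableZ 0 mA (iF 0%N); congr Cintegrable.
  by apply/funext => t; rewrite mul0r.
under eq_fun do rewrite big_ord_recr.
by apply: CintegrableD => //; exact: CintegrableZ.
Qed.

Lemma Cintegral_sum (A : set R) n (z : nat -> C) (F : nat -> R -> C) : measurable A ->
  (forall j, Cintegrable A (F j)) ->
  Cintegral A (fun t => \sum_(j < n) z j * F j t) = \sum_(j < n) z j * Cintegral A (F j).
Proof.
move=> mA iF; elim: n => [|n IH].
  rewrite big_ord0 (@eq_Cintegral _ _ _ (fun t => 0 * F 0%N t)).
    by rewrite CintegralZ// mul0r.
  by move=> t _; rewrite big_ord0 mul0r.
rewrite big_ord_recr/= -IH -CintegralZ// -CintegralD//.
- by apply: eq_Cintegral => t _; rewrite big_ord_recr.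
- exact: Cintegrable_sum.
- exact: CintegrableZ.
Qed.

Lemma continuous_monomial (A : set R) j : {within A, continuous (fun t : R => t ^+ j)}.
Proof. by apply: continuous_subspaceT => t; exact: exprn_continuous. Qed.

Lemma continuous_hornerZ (A : set R) (p : {poly R}) (c : R) :
  {within A, continuous (fun t => p.[c * t])}.
Proof.
apply: continuous_subspaceT => t; apply: continuous_comp; last exact: continuous_horner.
by apply: cvgM; [exact: cvg_cst|exact: cvg_id].
Qed.

Lemma Cintegral_horner a b K (p : {poly R}) n (c : R) : Cintegrable `[a, b] K -> (size p <= n)%N ->
  Cintegral `[a, b] (fun t => K t * (p.[c * t])%:C) =
  \sum_(j < n) (p`_j * c ^+ j)%:C * Cintegral `[a, b] (fun t => K t * (t ^+ j)%:C).
Proof.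
move=> iK pn; have iF j : Cintegrable `[a, b] (fun t => K t * (t ^+ j)%:C).
  by apply: Cintegrable_mulr => //; exact: continuous_monomial.
apply: etrans (Cintegral_sum n (fun j => (p`_j * c ^+ j)%:C) (measurable_itv _) iF).
apply: eq_Cintegral => t _; rewrite (horner_coef_wide _ pn) rmorph_sum mulr_sumr.
apply: eq_bigr => j _.
by rewrite exprMn [p`_j * _]mulrA rmorphM /= [LHS]mulrCA.
Qed.

(** Both sides of the transmutation identity are expanded in powers of [s]; the
    difference of their [k]-th coefficients is the difference of the two sides of
    the conclusion divided by k!. *)
Lemma moments (b : R) (f K : R -> C) (x : R) : 0 <= b -> Ccontinuous `[0, b] f ->
  (forall y, 0 <= y <= b -> f y != 0) -> 0 <= x <= b -> Cintegrable `[- x, x] K ->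
  (forall s : R, exists v, [/\ Ccontinuous `[0, b] v,
    forall y, y \in `[0, b] -> v y = 1 + Cintegral `[0, y] (fun z =>
      (s%:C + s%:C ^+ 2 * Cintegral `[0, z] (fun t => f t ^+ 2 * v t)) / f z ^+ 2) &
    f x * v x = (expR (s * x))%:C + Cintegral `[- x, x] (fun t => K t * (expR (s * t))%:C)]) ->
  forall k, Cintegral `[- x, x] (fun t => K t * (t ^+ k)%:C) =
    f x * ratio_power f k x - (x ^+ k)%:C.
Proof.
move=> b0 cf f0 /andP[x0 xb] iK ve k.
have [Q Q0 KQ] := Cintegral_mulr_bounded iK.
have [del del0 vexp] := volterra_expansion b0 cf f0.
(* Any even order above [k] would do. *)
pose m := k.+1; have [M vM] := vexp m; pose n := m.*2.
have kn : (k < n)%N by rewrite /n /m doubleS ltnS (leq_trans (leq_addr k k))// addnn leqW.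
pose mom j := Cintegral `[- x, x] (fun t => K t * (t ^+ j)%:C).
pose c j := (f x * ratio_power f j x - (x ^+ j)%:C - mom j) / (j`!)%:R.
have xin : x \in `[0, b] by rewrite in_itv/= x0.
suff ck0 : c k = 0.
  move/eqP: ck0; rewrite mulf_eq0 invr_eq0 pnatr_eq0 -[k`! == 0%N]negbK -lt0n fact_gt0 orbF.
  by rewrite subr_eq0 => /eqP ->.
pose del' := Num.min 1 del.
have del'0 : 0 < del' by rewrite lt_min ltr01.
apply: (@Cpoly_small_eq0 _ n c del' (N1 (f x) * M + (1 + Q) * (x ^+ n * expR x))) => //.
move=> s /andP[s0]; rewrite le_min => /andP[s1 sdel].
have [v [cv vE ev]] := ve s.
have sdel' : 0 < s <= del by rewrite s0.
have := vM s v sdel' cv vE x xin; rewrite -/n.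
set D := v x - _ => Dle.
pose rem t := expR (s * t) - (exp_poly n).[s * t].
have crem : {within `[- x, x], continuous rem}.
  move=> t; apply: cvgB; last exact: continuous_hornerZ.
  have : continuous (fun t : R => expR (s * t)).
    move=> y; apply: continuous_comp; last exact: continuous_expR.
    by apply: cvgM; [exact: cvg_cst|exact: cvg_id].
  by move=> /(continuous_subspaceT (A := `[- x, x])); exact.
have remM t : t \in `[- x, x] -> `|rem t| <= s ^+ n * (x ^+ n * expR x).
  rewrite in_itv/= -ler_norml => tx; apply: le_trans (expR_taylor _ _) _.
  rewrite mulrA -exprMn.
  have stx : `|s * t| <= s * x by rewrite normrM gtr0_norm// ler_wpM2l// ltW.
  rewrite ler_pM ?exprn_ge0 ?expR_ge0//.
    by rewrite lerXn2r ?nnegrE// mulr_ge0// ltW.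
  by rewrite ler_expR (le_trans stx)// ler_piMl.
have -> : \sum_(j < n) c j * (s ^+ j)%:C =
    - (f x * D) + (rem x)%:C + Cintegral `[- x, x] (fun t => K t * (rem t)%:C).
  have -> : Cintegral `[- x, x] (fun t => K t * (rem t)%:C) =
      Cintegral `[- x, x] (fun t => K t * (expR (s * t))%:C) -
      Cintegral `[- x, x] (fun t => K t * ((exp_poly n).[s * t])%:C).
    rewrite -CintegralB//.
    - by apply: eq_Cintegral => t _; rewrite rmorphB mulrBr.
    - apply: Cintegrable_mulr => //; apply: continuous_subspaceT => y.
      apply: continuous_comp; last exact: continuous_expR.
      by apply: cvgM; [exact: cvg_cst|exact: cvg_id].
    - by apply: Cintegrable_mulr => //; exact: continuous_hornerZ.
  have -> : Cintegral `[- x, x] (fun t => K t * ((exp_poly n).[s * t])%:C) =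
      \sum_(j < n) ((exp_poly n)`_j * s ^+ j)%:C * mom j.
    by rewrite (Cintegral_horner _ iK (size_poly _ _)).
  have -> : \sum_(j < n) c j * (s ^+ j)%:C =
      f x * (\sum_(j < n) ratio_power f j x / (j`!)%:R * (s ^+ j)%:C) -
      ((exp_poly n).[s * x])%:C - \sum_(j < n) ((exp_poly n)`_j * s ^+ j)%:C * mom j.
    rewrite horner_exp_poly rmorph_sum mulr_sumr -!sumrB; apply: eq_bigr => j _.
    rewrite coef_poly ltn_ord /c exprMn !rmorphM fmorphV rmorph_nat /=.
    by move: (j`!%:R^-1) (s ^+ j)%:C (x ^+ j)%:C (mom j) => i1 i2 i3 i4; ring.
  rewrite /D mulrBr ev /rem rmorphB.
  by rewrite !opprD !opprK; ring.
apply: le_trans (N1D _ _) _.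
have -> : (N1 (f x) * M + (1 + Q) * (x ^+ n * expR x)) * s ^+ n =
  N1 (f x) * (M * s ^+ n) + s ^+ n * (x ^+ n * expR x) + Q * (s ^+ n * (x ^+ n * expR x)).
  by move: (s ^+ n) (x ^+ n * _) (N1 _) => i1 i2 i3; ring.
apply: lerD; last exact: KQ.
apply: le_trans (N1D _ _) _; apply: lerD.
  rewrite N1N; apply: le_trans (N1M _ _) _.
  by rewrite ler_wpM2l ?N1_ge0.
by rewrite N1r; apply: remM; rewrite in_itv/= lexx andbT; lra.
Qed.

End Moments.

(** * Legendre polynomials on a symmetric interval *)
Section Legendre.
Context {R : realType}.
Local Notation mu := (@lebesgue_measure R).
Implicit Types (p q : {poly R}) (n m k : nat).

Lemma size_legendre n : (size (legendre n : {poly R}) <= n.+1)%N.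
Proof.
apply: leq_trans (size_scale_leq _ _) _; apply/leq_sizeP => i ni.
rewrite coef_derivn nth_default ?mul0rn//.
have sX : size ('X^2 - 1 : {poly R}) = 3%N by rewrite size_XnsubC.
rewrite (leq_trans (size_poly_exp_leq _ _))// sX /= mul2n -addnn.
by rewrite -addSn addnC leq_add2l.
Qed.

(** Rodrigues' polynomial is a polynomial in X^2. *)
Lemma legendre_parity n k : odd (n + k) -> (legendre n : {poly R})`_k = 0.
Proof.
move=> onk; rewrite coefZ coef_derivn.
have -> : ('X^2 - 1 : {poly R}) ^+ n = (('X - 1) ^+ n) \Po 'X^2.
  by rewrite rmorphXn/= comp_polyB comp_polyX -[X in _ \Po X]/('X^2) comp_polyC.
by rewrite coef_comp_poly_Xn// dvdn2 onk/= mul0rn mulr0.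
Qed.

(** Rodrigues' polynomial vanishes at both ends to order [n]; the cofactor of
    its [n]-th derivative gives the values of the Legendre polynomial there. *)
Lemma derivn_rodrigues n k : (k <= n)%N -> exists s : {poly R},
  [/\ (('X^2 - 1) ^+ n)^`(k) = ('X^2 - 1) ^+ (n - k) * s,
      s.[1] = (2 ^ k * n ^_ k)%:R & s.[-1] = (-1) ^+ k * (2 ^ k * n ^_ k)%:R].
Proof.
elim: k => [_|k IH kn].
  by exists 1; rewrite derivn0 subn0 mulr1 !hornerC ffactn0 expr0 mul1r muln1.
have [s [E s1 sN1]] := IH (ltnW kn).
exists ((n - k)%:R *: ('X *+ 2 * s) + ('X^2 - 1) * s^`()); split.
- rewrite derivnS E derivM deriv_exp derivB derivXn derivC subr0 /= expr1.
  have -> : (n - k)%N = (n - k.+1).+1 by rewrite subnSK.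
  move: (n - k.+1)%N => m /=; set r : {poly R} := 'X^2 - 1; move: r => r.
  rewrite exprS -mul_polyC rmorph_nat -[in LHS]mulr_natl.
  by move: (m.+1%:R) (s^`()) => c s'; ring.
- rewrite ffactnSr expnSr !natrM.
  rewrite !(hornerD, hornerZ, hornerM, hornerMn, hornerX, hornerXn, hornerN, hornerC).
  by rewrite s1 natrM; ring.
- rewrite ffactnSr expnSr !natrM.
  rewrite !(hornerD, hornerZ, hornerM, hornerMn, hornerX, hornerXn, hornerN, hornerC).
  by rewrite sN1 natrM [(-1) ^+ k.+1]exprS; move: ((-1) ^+ k) => e; ring.
Qed.

Lemma legendre_at_ends n :
  (legendre n : {poly R}).[1] = 1 /\ (legendre n : {poly R}).[-1] = (-1) ^+ n.
Proof.
have [s [E s1 sN1]] := derivn_rodrigues (leqnn n).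
have n0 : (2 ^ n * n`!)%:R != 0 :> R by rewrite pnatr_eq0 -lt0n muln_gt0 expn_gt0 fact_gt0.
rewrite /legendre E subnn expr0 mul1r !hornerZ s1 sN1 ffactnn.
by rewrite mulVf// mulrCA mulVf// mulr1.
Qed.

Lemma derivn_rodrigues_ends n k : (k < n)%N ->
  ((('X^2 - 1) ^+ n)^`(k) : {poly R}).[1] = 0 /\ ((('X^2 - 1) ^+ n)^`(k) : {poly R}).[-1] = 0.
Proof.
move=> kn; have [s [-> _ _]] := derivn_rodrigues (ltnW kn).
rewrite !hornerM !horner_exp !hornerE /=.
have -> : (n - k)%N = (n - k.+1).+1 by rewrite subnSK.
by rewrite !exprS !expr0 !mulr1 mulrN1 opprK subrr !mul0r.
Qed.

Section Interval.
Variable x : R.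
Hypothesis x_gt0 : 0 < x.

(** The substitution t/x is kept inside the integrand, so the results apply as they
    stand to expansions on the interval from -x to x. *)
Definition horner_integral p : R := \int[mu]_(t in `[- x, x]) p.[t / x].

Lemma continuous_horner_div (A : set R) p : {within A, continuous (fun t => p.[t / x])}.
Proof.
have -> : (fun t => p.[t / x]) = (fun t => p.[x^-1 * t]).
  by apply/funext => t; rewrite mulrC.
exact: continuous_hornerZ.
Qed.

Let pintable p : mu.-integrable `[- x, x] (EFin \o (fun t => p.[t / x])).
Proof. by apply: continuous_integrable; exact: continuous_horner_div. Qed.

Lemma horner_integralD p q : horner_integral (p + q) = horner_integral p + horner_integral q.
Proof. by rewrite /horner_integral -RintegralD//; apply: eq_Rintegral => t _; rewrite hornerD. Qed.

Lemma horner_integralZ c p : horner_integral (c *: p) = c * horner_integral p.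
Proof. by rewrite /horner_integral -RintegralZl//; apply: eq_Rintegral => t _; rewrite hornerZ. Qed.

Lemma horner_integral_deriv p : horner_integral p^`() = x * (p.[1] - p.[-1]).
Proof.
have xn0 : x != 0 by rewrite gt_eqF.
transitivity (x * p.[x / x] - x * p.[- x / x]); last by rewrite mulNr divff// mulrBr.
apply: (@integral_derive _ _ (fun t => x * p.[t / x])).
- by rewrite ge0_cp// ltW.
- by move=> t; apply: cvgM; [exact: cvg_cst|exact: continuous_horner_div].
- exact: continuous_horner_div.
- move=> t _.
  have dp (y : R) : is_derive y 1 (horner p) (p^`().[y]).
    by split; [exact: derivable_horner|rewrite -derive1E -derivE].
  have dl : is_derive t 1 (fun t : R => t / x) (x^-1).
    apply/is_derive1_caratheodory; exists (cst x^-1); split => //.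
      by move=> z /=; rewrite -mulrBl mulrC.
    exact: cvg_cst.
  have d1 := @is_derive1_comp _ (horner p) (fun t => t / x) _ _ _ (dp (t / x)) dl.
  apply: (is_derive_eq (@is_deriveZ _ _ _ _ x _ _ _ d1)).
  by rewrite /GRing.scale/= mulrCA divff// mulr1.
Qed.

(** Repeated integration by parts; the boundary terms vanish because derivatives
    of order below [n] of Rodrigues' polynomial vanish at both ends. *)
Lemma horner_integral_rodrigues n p k : (k <= n)%N ->
  horner_integral ((('X^2 - 1) ^+ n)^`(n) * p) =
  (-1) ^+ k * horner_integral ((('X^2 - 1) ^+ n)^`(n - k) * p^`(k)).
Proof.
elim: k => [_|k IH kn]; first by rewrite expr0 mul1r subn0 derivn0.
rewrite IH ?(ltnW kn)// [(-1) ^+ k.+1]exprSr -[RHS]mulrA; congr (_ * _).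
have -> : (n - k)%N = (n - k.+1).+1 by rewrite subnSK.
have nk : (n - k.+1 < n)%N by rewrite ltn_subrL/= (leq_trans _ kn).
have [e1 eN1] := derivn_rodrigues_ends nk.
have := horner_integral_deriv ((('X^2 - 1) ^+ n)^`(n - k.+1) * p^`(k)).
rewrite derivM !hornerM e1 eN1 !mul0r subrr mulr0 horner_integralD -!derivnS.
by rewrite mulN1r => /eqP; rewrite addr_eq0 => /eqP.
Qed.

Lemma legendre_orthogonal_size n p : (size p <= n)%N -> horner_integral (legendre n * p) = 0.
Proof.
move=> pn; rewrite /legendre -scalerAl horner_integralZ.
rewrite (horner_integral_rodrigues p (leqnn n)) subnn.
have -> : p^`(n) = 0.
  by apply/polyP => i; rewrite coef_derivn coef0 nth_default ?mul0rn// (leq_trans pn)// leq_addr.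
by rewrite mulr0 -(scale0r 0) horner_integralZ mul0r !mulr0.
Qed.

Lemma legendre_orthogonal n m : n != m -> horner_integral (legendre n * legendre m) = 0.
Proof.
rewrite neq_ltn => /orP[nm|mn].
- by rewrite mulrC legendre_orthogonal_size// (leq_trans (size_legendre n)).
- by rewrite legendre_orthogonal_size// (leq_trans (size_legendre m)).
Qed.

(** Integrating the derivative of zP^2 over the interval, where zP' equals nP
    up to terms of lower degree, which are orthogonal to P. *)
Lemma legendre_norm n : (2 * n + 1)%:R * horner_integral (legendre n * legendre n) = 2 * x.
Proof.
set P := legendre n.
have [P1 PN1] := legendre_at_ends n.
have := horner_integral_deriv ('X * (P * P)).
rewrite !hornerM !hornerX P1 PN1.
have -> : x * (1 * (1 * 1) - (- 1) * ((-1) ^+ n * (-1) ^+ n)) = 2 * x.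
  by rewrite -exprD addnn -mul2n exprM sqrrN expr1n expr1n; ring.
move=> <-.
(* The coefficients of degree [n] cancel. *)
pose L := 'X * P^`() - n%:R *: P.
have sL : (size L <= n)%N.
  apply/leq_sizeP => i ni; rewrite coefB coefZ coefXM coef_deriv.
  case: i ni => [|i] ni /=.
    by move: ni; rewrite leqn0 => /eqP ->; rewrite mul0r subrr.
  move: ni; rewrite leq_eqVlt => /predU1P[->|ni].
    by rewrite mulr_natl subrr.
  by rewrite nth_default ?mul0rn ?mulr0 ?subrr// (leq_trans (size_legendre n)).
have -> : ('X * (P * P))^`() = (2 * n + 1)%:R *: (P * P) + 2%:R *: (P * L).
  rewrite !derivM derivX /L -!mul_polyC !polyC_natr natrD natrM; ring.
by rewrite horner_integralD !horner_integralZ (legendre_orthogonal_size sL) mulr0 addr0.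
Qed.

End Interval.
End Legendre.

(** * Integrals under reflection *)
Section Reflection.
Context {R : realType}.
Local Notation mu := (@lebesgue_measure R).
Implicit Types (g : R -> R) (x : R).

Let sym x : -%R @^-1` `[- x, x] = `[- x, x]%classic.
Proof. by rewrite opp_preimage_itvbndbnd/= opprK. Qed.

(** Reflection preserves Lebesgue measure, so this is an image measure formula. *)
Let ge0_integral_opp x (h : R -> \bar R) : measurable_fun `[- x, x] h ->
  (forall t, (0 <= h t)%E) ->
  (\int[mu]_(t in `[(- x)%R, x]) h (- t)%R = \int[mu]_(t in `[(- x)%R, x]) h t)%E.
Proof.
move=> mh h0.
transitivity (\int[mu]_(t in (-%R : _ -> measurableTypeR R) @^-1` `[(- x)%R, x])
  (h \o (-%R : _ -> measurableTypeR R)) t)%E; first by rewrite sym.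
rewrite -ge0_integral_pushforward//=.
by apply: eq_measure_integral => A mA _; exact: lebesgue_measureN.
Qed.

Lemma integrable_opp x g : mu.-integrable `[- x, x] (EFin \o g) ->
  mu.-integrable `[- x, x] (EFin \o (fun t => g (- t))).
Proof.
move=> /integrableP[mg fg]; apply/integrableP; split.
  apply: (@measurable_comp _ _ _ _ _ _ `[- x, x] (EFin \o g) _ (-%R : R -> R)) => //.
    move=> _ [t + <-]; rewrite /= !in_itv/= => /andP[h1 h2].
    by rewrite lerN2 h2 lerNl h1.
rewrite (ge0_integral_opp (h := fun t => `|(g t)%:E|%E))//.
exact: measurableT_comp.
Qed.

Lemma integral_opp x g : mu.-integrable `[- x, x] (EFin \o g) ->
  \int[mu]_(t in `[- x, x]) g (- t) = \int[mu]_(t in `[- x, x]) g t.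
Proof.
move=> /integrableP[mg _]; rewrite /Rintegral; congr fine.
rewrite integralE [RHS]integralE; congr (_ - _)%E.
- apply: etrans _ (ge0_integral_opp (measurable_funepos mg) (funepos_ge0 _)).
  apply: eq_integral => t _.
  by rewrite -[RHS]/(((EFin \o g)^\+ \o -%R) t)%E -funepos_comp.
- apply: etrans _ (ge0_integral_opp (measurable_funeneg mg) (funeneg_ge0 _)).
  apply: eq_integral => t _.
  by rewrite -[RHS]/(((EFin \o g)^\- \o -%R) t)%E -funeneg_comp.
Qed.

End Reflection.

(** * Coefficients of Fourier-Legendre expansions *)
Section Expansions.
Context {R : realType}.
Local Notation C := R[i].
Local Notation mu := (@lebesgue_measure R).
Local Notation Re := (@complex.Re R).
Local Notation Im := (@complex.Im R).
Implicit Types (F K u : R -> C) (x : R).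

(** From 2 r <= del + r^2 / del. It replaces the Cauchy-Schwarz inequality: with
    [del] of the size of the L2 distance, it bounds an L1 norm by a multiple of
    that distance. *)
Lemma N1_le_normc (z : C) (del : R) : 0 < del ->
  N1 z <= del + del^-1 * Normc.normc z ^+ 2.
Proof.
move=> del0; have h := normr_Re_le z; have h' := normr_Im_le z.
apply: (@le_trans _ _ (2 * Normc.normc z)).
  by rewrite /N1 mulr_natl mulr2n lerD.
move: (Normc.normc z) => r; rewrite -(ler_pM2l del0) mulrDr mulVKf ?gt_eqF//.
have := sqr_ge0 (r - del); rewrite sqrrB; nra.
Qed.

Lemma N1_Cintegral_le_integral (a b : R) u (g : R -> R) : Cintegrable `[a, b] u ->
  mu.-integrable `[a, b] (EFin \o g) -> (forall t, t \in `[a, b] -> N1 (u t) <= g t) ->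
  N1 (Cintegral `[a, b] u) <= \int[mu]_(t in `[a, b]) g t.
Proof.
move=> [u1 u2] ig ug; have n1 := integrable_norm u1; have n2 := integrable_norm u2.
apply: (@le_trans _ _ (\int[mu]_(t in `[a, b]) `|Re (u t)| + \int[mu]_(t in `[a, b]) `|Im (u t)|)).
  by rewrite lerD// le_normr_Rintegral.
rewrite -RintegralD//; apply: le_Rintegral => //.
by apply: Rintegrable_add.
Qed.

Lemma Cintegral_real (A : set R) (g : R -> R) :
  Cintegral A (fun t => (g t)%:C) = (\int[mu]_(t in A) g t)%:C.
Proof.
apply: complex_ext => //=.
by rewrite /Rintegral (eq_integral (cst 0%E))// integral0.
Qed.

Lemma Cintegrable_real (a b : R) (g : R -> R) : {within `[a, b], continuous g} ->
  Cintegrable `[a, b] (fun t => (g t)%:C).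
Proof.
by move=> cg; apply: Ccontinuous_int; split => //= t; exact: cvg_cst.
Qed.

Lemma Cintegrable_opp x u : Cintegrable `[- x, x] u -> Cintegrable `[- x, x] (fun t => u (- t)).
Proof.
by move=> [u1 u2]; split; [exact: (integrable_opp u1)|exact: (integrable_opp u2)].
Qed.

Lemma Cintegral_opp x u : Cintegrable `[- x, x] u ->
  Cintegral `[- x, x] (fun t => u (- t)) = Cintegral `[- x, x] u.
Proof.
by move=> [u1 u2]; apply: complex_ext; [exact: (integral_opp u1)|exact: (integral_opp u2)].
Qed.

Lemma normc_sqr (z : C) : Normc.normc z ^+ 2 = Re z ^+ 2 + Im z ^+ 2.
Proof. by case: z => a b /=; rewrite sqr_sqrtr// addr_ge0// sqr_ge0. Qed.

(** Convergence in L2 gives convergence of the Fourier coefficients, and those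
    of the partial sums are eventually constant by orthogonality. *)
Lemma legendre_expansion_coef x (p : nat -> nat) F (c : nat -> C) : 0 < x ->
  injective p -> Cintegrable `[- x, x] F -> legendre_expansion x p F c ->
  forall n, c n = ((p n)%:R + 2^-1) *
    Cintegral `[- x, x] (fun t => F t * ((legendre (p n)).[t / x])%:C).
Proof.
move=> x0 pinj iF Fc n.
have mI : measurable `[(- x), x]%classic by exact: measurable_itv.
have cP (q : {poly R}) : {within `[- x, x], continuous (fun t => q.[t / x])}.
  exact: continuous_horner_div.
pose P := legendre (p n) : {poly R}.
have [B B0 PB] := continuous_bounded (cP P).
have iFP : Cintegrable `[- x, x] (fun t => F t * (P.[t / x])%:C) by apply: Cintegrable_mulr.
pose G j := fun t : R => (((legendre (p j) * P).[t / x])%:C : C).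
have iG j : Cintegrable `[- x, x] (G j) by apply: Cintegrable_real; exact: cP.
pose kappa := Cintegral `[- x, x] (fun t => F t * (P.[t / x])%:C) -
  c n / x%:C * (horner_integral x (P * P))%:C.
pose D m t := F t - legendre_partial_sum x p c m t.
have iS m : Cintegrable `[- x, x] (legendre_partial_sum x p c m).
  rewrite /legendre_partial_sum.
  rewrite (_ : (fun t => _) = (fun t => \sum_(j < m) c j / x%:C *
      (fun t => ((legendre (p j)).[t / x])%:C) t)); last first.
    by apply/funext => t; rewrite big_mkord.
  exact: (Cintegrable_sum m (fun j => c j / x%:C) mI
    (fun j => Cintegrable_real (cP (legendre (p j))))).
have iD m : Cintegrable `[- x, x] (D m) by exact: CintegrableB.
have kappaE m : (n < m)%N -> Cintegral `[- x, x] (fun t => D m t * (P.[t / x])%:C) = kappa.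
  move=> nm.
  rewrite (@eq_Cintegral _ _ _ (fun t => F t * (P.[t / x])%:C -
      \sum_(j < m) c j / x%:C * G j t)); last first.
    move=> t _; rewrite /D mulrBl; congr (_ - _).
    rewrite /legendre_partial_sum big_mkord mulr_suml; apply: eq_bigr => j _.
    by rewrite /G hornerM rmorphM mulrA.
  rewrite CintegralB//; last exact: (Cintegrable_sum m (fun j => c j / x%:C) mI iG).
  congr (_ - _); rewrite (Cintegral_sum m (fun j => c j / x%:C) mI iG).
  rewrite (bigD1 (Ordinal nm))//= big1 ?addr0; first by rewrite /G Cintegral_real.
  move=> j jn; rewrite /G Cintegral_real -/(horner_integral x _) legendre_orthogonal ?mulr0//.
  by apply: contra jn => /eqP/pinj jn; apply/eqP/val_inj.
have kappa0 : kappa = 0.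
  suff : N1 kappa = 0.
    move=> /eqP; rewrite paddr_eq0// !normr_eq0 => /andP[/eqP k1 /eqP k2].
    exact: complex_ext.
  apply/eqP; rewrite eq_le N1_ge0 andbT; apply/ler_addgt0Pl => e e0; rewrite addr0.
  (* Once the squared L2 distance is below [del ^+ 2], the pairing with [P] is at
     most B (2 x del + del^2 / del); the final 1 keeps [A] positive. *)
  pose A := B * (2 * x + 1) + 1.
  have A0 : 0 < A by rewrite ltr_wpDl// mulr_ge0// addr_ge0// mulr_ge0// ltW.
  pose del := e / A; have del0 : 0 < del by rewrite divr_gt0.
  have del2 : (0 < (del ^+ 2)%:E :> \bar R)%E by rewrite lte_fin exprn_gt0.
  have [m0 _ /(_ (maxn m0 n.+1) (leq_maxl _ _))/=] := Fc _ (open_ereal_lt' del2).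
  set m := maxn m0 n.+1 => small.
  have nm : (n < m)%N by rewrite /m leq_max ltnSn orbT.
  rewrite -(kappaE _ nm).
  have [D1 D2] := iD m.
  pose N t := Normc.normc (D m t) ^+ 2.
  have NE t : N t = Re (D m t) ^+ 2 + Im (D m t) ^+ 2 by exact: normc_sqr.
  have mN : measurable_fun `[- x, x] N.
    rewrite (funext NE); apply: measurable_funD; apply: measurable_funX.
      exact: integrable_measurable D1.
    exact: integrable_measurable D2.
  have iNo : mu.-integrable `](- x), x[ (EFin \o N).
    apply/integrableP; split.
      by apply/measurable_EFinP; apply: measurable_funS mN => //; exact: subset_itv_oo_cc.
    apply: le_lt_trans (lt_trans small (ltry _)).
    rewrite le_eqVlt; apply/orP; left; apply/eqP; apply: eq_integral => t _.
    by rewrite /= ger0_norm// sqr_ge0.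
  have iN := integrable_itv_oo_cc iNo.
  have Nsmall : \int[mu]_(t in `[- x, x]) N t <= del ^+ 2.
    rewrite -Rintegral_itv_oo_cc// -lee_fin /Rintegral fineK; first exact: ltW.
    exact: integrable_fin_num.
  have icst : mu.-integrable `[- x, x] (EFin \o (fun=> del)).
    by apply: continuous_integrable => t; exact: cvg_cst.
  have ib : mu.-integrable `[- x, x] (EFin \o (fun t => del + del^-1 * N t)).
    by apply: Rintegrable_add => //; exact: Rintegrable_scale.
  apply: (@le_trans _ _ (\int[mu]_(t in `[- x, x]) (B * (del + del^-1 * N t)))).
    apply: N1_Cintegral_le_integral; first exact: Cintegrable_mulr.
      exact: Rintegrable_scale.
    move=> t tx; apply: le_trans (N1M _ _) _; rewrite N1r mulrC.
    by rewrite ler_pM ?N1_ge0// ?PB// N1_le_normc.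
  rewrite RintegralZl// RintegralD//; last exact: Rintegrable_scale.
  have -> : \int[mu]_(t in `[- x, x]) (del^-1 * N t) = del^-1 * \int[mu]_(t in `[- x, x]) N t.
    by rewrite RintegralZl.
  have -> : \int[mu]_(_ in `[- x, x]) del = del * (2 * x).
    rewrite Rintegral_cst//= lebesgue_measure_itv/= lte_fin gtrN// -EFinB/= opprK.
    by ring.
  apply: (@le_trans _ _ (B * (del * (2 * x) + del))).
    rewrite ler_wpM2l// lerD2l -ler_pdivlMl ?invr_gt0//.
    by rewrite invrK -expr2.
  have -> : e = del * A by rewrite /del divfK// gt_eqF.
  move: (del) del0 => d d0; have -> : d * A = B * (d * (2 * x) + d) + d by rewrite /A; ring.
  by rewrite lerDl ltW.
move: kappa0; rewrite /kappa => /eqP; rewrite subr_eq0 => /eqP ->.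
have xn0 : x%:C != 0 :> C by rewrite fmorph_eq0 gt_eqF.
have nn0 : (2 * p n + 1)%:R != 0 :> R by rewrite pnatr_eq0 addn1.
have -> : horner_integral x (P * P) = 2 * x / (2 * p n + 1)%:R.
  by rewrite -(legendre_norm x0 (p n)) mulrAC divff// mul1r.
rewrite rmorphM fmorphV rmorphM !rmorph_nat natrD natrM.
field; rewrite xn0 /=.
by rewrite andbT -(natrM _ 2 (p n)) natr1 pnatr_eq0.
Qed.

Lemma legendre_opp n (y : R) :
  (legendre n : {poly R}).[- y] = (-1) ^+ n * (legendre n : {poly R}).[y].
Proof.
rewrite !horner_coef mulr_sumr; apply: eq_bigr => k _.
have [onk|enk] := boolP (odd (n + k)); first by rewrite legendre_parity// !mul0r mulr0.
rewrite [(- y) ^+ k]exprNn !mulrA [_ * (-1) ^+ k]mulrC; congr (_ * _ * _).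
by rewrite -signr_odd -[in RHS]signr_odd; move: enk; rewrite oddD; do 2 case: odd.
Qed.

Lemma sum_even (G : nat -> C) n : (forall k, G (2 * k).+1 = 0) ->
  \sum_(0 <= k < (2 * n).+1) G k = \sum_(0 <= k < n.+1) G (2 * k)%N.
Proof.
move=> G0; elim: n => [|n IH]; first by rewrite !big_nat1.
rewrite mulnS big_nat_recr//= [in RHS]big_nat_recr//= -IH.
by rewrite big_nat_recr//= G0 addr0 mulnS.
Qed.

Lemma sum_odd (G : nat -> C) n : (forall k, G (2 * k)%N = 0) ->
  \sum_(0 <= k < (2 * n).+2) G k = \sum_(0 <= k < n.+1) G (2 * k).+1.
Proof.
move=> G0; elim: n => [|n IH].
  by rewrite big_nat_recr//= !big_nat1 (G0 0%N) add0r.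
rewrite mulnS big_nat_recr//= big_nat_recr//= [in RHS]big_nat_recr//= -IH.
by rewrite -[(2 + 2 * n)%N]mulnS G0 addr0 mulnS.
Qed.

(** The powers of [x] in the moments cancel those of t/x, leaving the sum of the
    coefficients of the Legendre polynomial, which is its value 1 at 1. *)
Lemma a_coef_of_moments (K : R -> R -> C) (f : R -> C) x : 0 < x -> Cintegrable `[- x, x] (K x) ->
  (forall k, Cintegral `[- x, x] (fun t => K x t * (t ^+ k)%:C) =
    f x * ratio_power f k x - (x ^+ k)%:C) ->
  forall n, a_coef K n x = (n%:R + 2^-1) *
    (\sum_(0 <= k < n.+1) legendre_coef k n * (phi_f f k x / x%:C ^+ k) - 1).
Proof.
move=> x0 iK mom n; have xn0 : x != 0 by rewrite gt_eqF.
rewrite /a_coef; congr (_ * _).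
rewrite (@eq_Cintegral _ _ _ (fun t => K x t * ((legendre n).[x^-1 * t])%:C)); last first.
  by move=> t _; rewrite [t / x]mulrC.
rewrite (Cintegral_horner _ iK (size_legendre n)) big_mkord.
have -> : 1 = \sum_(k < n.+1) legendre_coef k n :> C.
  rewrite /legendre_coef -rmorph_sum; have [P1 _] := @legendre_at_ends R n.
  transitivity (((legendre n).[1])%:C : C); first by rewrite P1.
  rewrite (horner_coef_wide _ (size_legendre n)) /=; congr (_%:C).
  by apply: eq_bigr => k _; rewrite expr1n mulr1.
rewrite -sumrB; apply: eq_bigr => k _; rewrite mom -[f x * _]/(phi_f f k x).
rewrite /legendre_coef exprVn rmorphM fmorphV !rmorphXn /=.
have : x%:C ^+ k != 0 :> C by rewrite expf_neq0// fmorph_eq0.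
move: (x%:C ^+ k) (phi_f f k x) ((legendre n)`_k)%:C => X0 ph l X0n.
by field.
Qed.

End Expansions.

(** * The coefficients of the canonical kernels *)
Theorem proposition33 (R : realType) (b : R) (q : R -> R[i]) (N : nat)
    (x_ : nat -> R) (alpha : nat -> R[i]) (f : R -> R[i]) (h : R[i])
    (e : R[i] -> R -> R[i]) (K : R -> R -> R[i])
  (b_gt0 : 0 < b) (q_L2 : L2 `]0, b[ q) (N_gt0 : (0 < N)%N)
  (x_0 : x_ 0%N = 0) (x_N1 : x_ N.+1 = b)
  (x_incr : forall k, (k <= N)%N -> x_ k < x_ k.+1)
  (alpha_neq0 : forall k, (1 <= k <= N)%N -> alpha k != 0)
  (f_sol : is_solution b q N x_ alpha 0 f)
  (f_neq0 : forall x, 0 <= x <= b -> f x != 0)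
  (f_0 : f 0 = 1) (f_deriv0 : deriv_right f 0 h)
  (e_sol : forall rho, is_e b q N x_ alpha h rho (e rho))
  (K_kernel : transmutation_kernel b e K) :
  forall x, 0 < x <= b ->
    [/\ forall n, a_coef K n x =
          (n%:R + 2^-1) *
          (\sum_(0 <= k < n.+1) legendre_coef k n * (phi_f f k x / x%:C ^+ k) - 1),
        forall n, g_coef K n x =
          (4 * n + 1)%:R *
          (\sum_(0 <= k < n.+1)
             legendre_coef (2 * k) (2 * n) *
             (phi_f f (2 * k) x / x%:C ^+ (2 * k)) - 1) &
        forall n, s_coef K n x =
          (4 * n + 3)%:R *
          (\sum_(0 <= k < n.+1)
             legendre_coef (2 * k).+1 (2 * n).+1 *
             (phi_f f (2 * k).+1 x / x%:C ^+ (2 * k).+1) - 1)] /\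
    [/\ forall c, legendre_expansion x id (K x) c ->
          forall n, c n = a_coef K n x,
        forall c, legendre_expansion x (fun n => 2 * n)%N (cosine_kernel K x) c ->
          forall n, c n = g_coef K n x &
        forall c, legendre_expansion x (fun n => (2 * n).+1)%N (sine_kernel K x) c ->
          forall n, c n = s_coef K n x].
Proof.
move=> x xb; have /andP[x0 xleb] := xb; have b0 := ltW b_gt0.
have [_ _ K_L2 e_K] := K_kernel.
have iK : Cintegrable `[- x, x] (K x) by exact/L2_Cintegrable/K_L2.
have cf : Ccontinuous `[0, b] f by case: f_sol => -[/abs_cont_Ccontinuous].
have real_exp (z : R[i]) (r : R) : z = r%:C -> expC z = (expR r)%:C.
  by move=> ->; rewrite /expC /= cos0 sin0 mulr1.
have mom : forall k, Cintegral `[- x, x] (fun t => K x t * (t ^+ k)%:C) =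
    f x * ratio_power f k x - (x ^+ k)%:C.
  apply: (moments b0 cf f_neq0 _ iK); first by rewrite (ltW x0).
  (* With this [rho] the number i rho is the real number [s], and the spectral
     parameter rho^2 is -s^2. *)
  move=> s; pose rho : R[i] := - 'i%C * s%:C; exists (fun y => e rho y / f y).
  have irho : 'i%C * rho = s%:C by rewrite mulrA mulrN -expr2 sqr_i opprK mul1r.
  have rho2 : rho ^+ 2 = - s%:C ^+ 2 by rewrite exprMn sqrrN sqr_i mulN1r.
  have [e_rho e_0 e_deriv0] := e_sol rho.
  rewrite rho2 in e_rho; rewrite irho in e_deriv0.
  have ce : Ccontinuous `[0, b] (e rho) by case: e_rho => -[/abs_cont_Ccontinuous].
  split.
  - by apply: CcontinuousM => //; apply: CcontinuousV => // t; rewrite /= in_itv/=; exact: f_neq0.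
  - move=> y yb; have yb' := yb; rewrite in_itv/= in yb'.
    rewrite (quotient_volterra b_gt0 x_0 x_N1 x_incr f_sol e_rho f_neq0 f_0 e_0
      f_deriv0 e_deriv0 yb').
    apply: (congr1 (fun w => 1 + w)); apply: eq_Cintegral => z zin.
    have /andP[z0 zy] : 0 <= z <= y by move: zin; rewrite /= in_itv.
    congr ((_ + _ * _) / _); apply: eq_Cintegral => t tin.
    have /andP[t0 tz] : 0 <= t <= z by move: tin; rewrite /= in_itv.
    have ft0 : f t != 0.
      apply: f_neq0; rewrite t0 (le_trans tz)// (le_trans zy)//.
      by case/andP: yb'.
    by move: (f t) (e rho t) ft0 => u v u0; field.
  - rewrite mulrC divfK ?f_neq0 ?(ltW x0)//.
    rewrite (e_K rho x xb) irho (real_exp _ (s * x)) ?rmorphM//; congr (_ + _).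
    by apply: eq_Cintegral => t _; rewrite (real_exp _ (s * t)) ?rmorphM.
have aE := a_coef_of_moments x0 iK mom.
have half2 (m : nat) : 2 * (m%:R + 2^-1) = (2 * m + 1)%:R :> R[i].
  by rewrite mulrDr divff ?pnatr_eq0// natrD natrM.
split; split.
- exact: aE.
- move=> n; rewrite /g_coef aE mulrA half2 mulnA; congr (_ * (_ - 1)).
  rewrite sum_even// => k.
  by rewrite /legendre_coef legendre_parity ?mul0r// addnS oddS oddD !oddM.
- move=> n; have E : (2 * (2 * n).+1 + 1 = 4 * n + 3)%N by rewrite mulnS mulnA addnAC addnC.
  rewrite /s_coef aE mulrA half2 E; congr (_ * (_ - 1)).
  rewrite sum_odd// => k.
  by rewrite /legendre_coef legendre_parity ?mul0r// addSn oddS oddD !oddM.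
- move=> c /(legendre_expansion_coef x0 (@inj_id _) iK) cE n; exact: cE.
- move=> c cK n.
  have iKN := Cintegrable_opp iK.
  have inj2 : injective (fun n => 2 * n)%N by move=> i j /eqP; rewrite eqn_mul2l => /eqP.
  rewrite (legendre_expansion_coef x0 inj2 _ cK); last exact: CintegrableD.
  rewrite /g_coef /a_coef mulrCA; congr (_ * _).
  pose P : {poly R} := legendre (2 * n).
  have cP : {within `[- x, x], continuous (fun t => P.[t / x])} by exact: continuous_horner_div.
  rewrite (@eq_Cintegral _ _ _ (fun t => K x t * (P.[t / x])%:C +
      (fun t => K x t * (P.[t / x])%:C) (- t))); last first.
    move=> t _; rewrite /cosine_kernel mulrDl mulNr legendre_opp.
    by rewrite -signr_odd oddM/= expr0 mul1r.
  have iKP : Cintegrable `[- x, x] (fun t => K x t * (P.[t / x])%:C) by exact: Cintegrable_mulr.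
  rewrite CintegralD//; last exact: (Cintegrable_opp iKP).
  by rewrite (Cintegral_opp iKP) mulr_natl mulr2n.
- move=> c cK n.
  have iKN := Cintegrable_opp iK.
  have inj2 : injective (fun n => (2 * n).+1)%N.
    by move=> i j /eqP; rewrite eqSS eqn_mul2l => /eqP.
  rewrite (legendre_expansion_coef x0 inj2 _ cK); last exact: CintegrableB.
  rewrite /s_coef /a_coef mulrCA; congr (_ * _).
  pose P : {poly R} := legendre (2 * n).+1.
  have cP : {within `[- x, x], continuous (fun t => P.[t / x])} by exact: continuous_horner_div.
  rewrite (@eq_Cintegral _ _ _ (fun t => K x t * (P.[t / x])%:C +
      (fun t => K x t * (P.[t / x])%:C) (- t))); last first.
    move=> t _; rewrite /sine_kernel mulrDl [in RHS]mulNr legendre_opp.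
    by rewrite -signr_odd oddS oddM/= expr1 mulN1r rmorphN mulrN mulNr.
  have iKP : Cintegrable `[- x, x] (fun t => K x t * (P.[t / x])%:C) by exact: Cintegrable_mulr.
  rewrite CintegralD//; last exact: (Cintegrable_opp iKP).
  by rewrite (Cintegral_opp iKP) mulr_natl mulr2n.
Qed.
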